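(* Let $f:A\to B$ be a ring homomorphism, where $A$ is a Noetherian local ring, and let $J$ be an ideal of $B$ that is contained in the Jacobson radical of $B$ and is finitely generated as an $A$-module (via $f$). Assume that $A$ is Cohen-Macaulay and that $\mathrm{Ann}_{f(A)+J}(J)=(0)$. If $A\bowtie^f J$ is Gorenstein, then $A$ has a canonical module isomorphic to $f^{-1}(J)$.
   Context: All rings are commutative with unity. $A\bowtie^f J:=\{(a,f(a)+j)\mid a\in A,\ j\in J\}$ is a subring of $A\times B$; under the hypotheses on $A$ and $J$ it is a Noetherian local ring. $f(A)+J=\{f(a)+j\mid a\in A,\ j\in J\}$ is a subring of $B$ of which $J$ is an ideal, and $\mathrm{Ann}_{f(A)+J}(J)=\{x\in f(A)+J\mid xJ=0\}$. *)

(* Defs.v *)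
From HB Require Import structures.
From mathcomp Require Import all_boot all_algebra.
From mathcomp Require Import generic_quotient ring_quotient.

Set Implicit Arguments.
Unset Strict Implicit.
Unset Printing Implicit Defensive.

Import GRing.Theory.
Local Open Scope ring_scope.
Local Open Scope quotient_scope.

(* Conventions.  Rings are commutative with unity and may be zero
   (comPzRingType).  Submodules and ideals are boolean predicates, which loses
   no generality under classical logic; the whole ring is an ideal, unlike in
   ring_quotient.v, where an idealr is proper.
   Cohen-Macaulay modules, type and canonical modules follow Bruns-Herzog,
   "Cohen-Macaulay rings". *)

Section Submodules.
Variables (R : comPzRingType) (V : lmodType R).

Record submodule := Submodule {
  submod_pred :> {pred V};
  submod_predP : submod_closed submod_pred
}.

Lemma submodule_subsemimod_closed (N : submodule) :
  GRing.subsemimod_closed (submod_pred N).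
Proof.
have [N0 NL] := submod_predP N; split; first split=> // x y xN yN.
  by have := NL 1 x y xN yN; rewrite scale1r.
by move=> a x xN; have := NL a x 0 xN N0; rewrite addr0.
Qed.

HB.instance Definition _ (N : submodule) :=
  GRing.isSubmodClosed.Build R V (submod_pred N)
    (submodule_subsemimod_closed N).

End Submodules.

Definition ideal (R : comPzRingType) := submodule (R^o : lmodType R).

Section Ideals.
Variables (R : comPzRingType) (I : ideal R).

Lemma ideal0 : (0 : R) \in submod_pred I.
Proof. exact: rpred0. Qed.

Lemma idealD (x y : R) :
  x \in submod_pred I -> y \in submod_pred I -> x + y \in submod_pred I.
Proof. exact: rpredD. Qed.

Lemma idealB (x y : R) :
  x \in submod_pred I -> y \in submod_pred I -> x - y \in submod_pred I.
Proof. exact: rpredB. Qed.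

Lemma idealM (a x : R) : x \in submod_pred I -> a * x \in submod_pred I.
Proof. exact: rpredZ. Qed.

End Ideals.

Record submod_of (R : comPzRingType) (V : lmodType R) (N : submodule V) :=
  SubmodOf { submod_val : V; submod_valP : submod_val \in submod_pred N }.

HB.instance Definition _ R V N := [isSub for @submod_val R V N].
HB.instance Definition _ R V (N : @submodule R V) :=
  [Choice of submod_of N by <:].
HB.instance Definition _ R V (N : @submodule R V) :=
  [SubChoice_isSubLmodule of submod_of N by <:].

Definition quot_mod (R : comPzRingType) (V : lmodType R) (N : submodule V) :=
  Quotient.quot (submod_pred N : zmodClosed V).

Section QuotientModule.
Variables (R : comPzRingType) (V : lmodType R) (N : submodule V).
Local Notation Q := (quot_mod N).

HB.instance Definition _ := GRing.Zmodule.on Q.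

Definition quot_pi (x : V) : Q := \pi x.
Definition quot_scale (a : R) (x : Q) : Q := quot_pi (a *: repr x).

Lemma quot_piP (x y : V) : (quot_pi x = quot_pi y) <-> (x - y \in submod_pred N).
Proof. by rewrite Quotient.idealrBE; split=> [/eqP|/eqP]. Qed.

Lemma quot_piK (q : Q) : quot_pi (repr q) = q.
Proof. exact: reprK. Qed.

Lemma quot_piD (x y : V) : quot_pi (x + y) = quot_pi x + quot_pi y.
Proof. by rewrite /quot_pi !piE. Qed.

Lemma quot_scale_pi a (x : V) : quot_scale a (quot_pi x) = quot_pi (a *: x).
Proof.
apply/quot_piP; rewrite -scalerBr rpredZ //.
exact/quot_piP/quot_piK.
Qed.

Fact quot_scaleA a b x : quot_scale a (quot_scale b x) = quot_scale (a * b) x.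
Proof. by rewrite -[x]quot_piK !quot_scale_pi scalerA. Qed.

Fact quot_scale1 : left_id 1 quot_scale.
Proof. by move=> x; rewrite -[x]quot_piK quot_scale_pi scale1r. Qed.

Fact quot_scaleDr : right_distributive quot_scale +%R.
Proof.
move=> a x y; rewrite -[x]quot_piK -[y]quot_piK -quot_piD !quot_scale_pi.
by rewrite scalerDr quot_piD.
Qed.

Fact quot_scaleDl x : {morph quot_scale^~ x : a b / a + b}.
Proof.
by move=> a b; rewrite -[x]quot_piK !quot_scale_pi scalerDl quot_piD.
Qed.

HB.instance Definition _ := GRing.Zmodule_isLmodule.Build R Q
  quot_scaleA quot_scale1 quot_scaleDr quot_scaleDl.

End QuotientModule.

Section ModuleTheory.
Variable R : comPzRingType.
Implicit Types (M N : lmodType R) (I P m : ideal R).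

Definition fin_gen M :=
  exists (n : nat) (v : 'I_n -> M),
    forall x : M, exists c : 'I_n -> R, x = \sum_i c i *: v i.

Definition isomorphic M N := exists phi : {linear M -> N}, bijective phi.

Definition proper_id I := 1 \notin submod_pred I.

Definition maximal_ideal m :=
  proper_id m /\
  forall I, {subset submod_pred m <= submod_pred I} -> proper_id I ->
    submod_pred I =i submod_pred m.

Definition prime_ideal P :=
  proper_id P /\
  forall x y : R, x * y \in submod_pred P ->
    x \in submod_pred P \/ y \in submod_pred P.

Definition in_jacobson_radical (x : R) :=
  forall m, maximal_ideal m -> x \in submod_pred m.

Definition noetherian := forall I, fin_gen (submod_of I).

Definition local_at m :=
  maximal_ideal m /\
  forall m', maximal_ideal m' -> submod_pred m' =i submod_pred m.

(* A strictly increasing chain p 0 < ... < p n of primes containing Ann M. *)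
Definition prime_chain M (n : nat) (p : nat -> ideal R) :=
  [/\ forall i, (i <= n)%N -> prime_ideal (p i),
      forall a : R, (forall x : M, a *: x = 0) -> a \in submod_pred (p 0%N) &
      forall i, (i < n)%N ->
        {subset submod_pred (p i) <= submod_pred (p i.+1)} /\
        exists2 x, x \in submod_pred (p i.+1) & x \notin submod_pred (p i)].

(* dim M = dim (R / Ann M) = n; for M = R^o this is the Krull dimension. *)
Definition has_dim M (n : nat) :=
  (exists p, prime_chain M n p) /\
  forall n' p, prime_chain M n' p -> (n' <= n)%N.

(* y lies in (s_0, ..., s_(k-1)) M. *)
Definition in_seq_mul M (s : seq R) (y : M) :=
  exists u : 'I_(size s) -> M, y = \sum_(i < size s) s`_i *: u i.

Definition regular_seq M (s : seq R) :=
  (forall i, (i < size s)%N -> forall y : M,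
     in_seq_mul (take i s) (s`_i *: y) -> in_seq_mul (take i s) y) /\
  exists y : M, ~ in_seq_mul s y.

(* depth M = n, for M finitely generated over R Noetherian and local at m: all
   maximal regular sequences in m have the same length, which is the maximum. *)
Definition has_depth m M (n : nat) :=
  (exists s : seq R,
     [/\ {subset s <= submod_pred m}, regular_seq M s & size s = n]) /\
  forall s : seq R,
    {subset s <= submod_pred m} -> regular_seq M s -> (size s <= n)%N.

(* The zero module is excluded: it has no regular sequence, hence no depth. *)
Definition cohen_macaulay_module m M :=
  fin_gen M /\ exists n, has_depth m M n /\ has_dim M n.

Definition maximal_cohen_macaulay m M :=
  cohen_macaulay_module m M /\
  exists n, has_dim M n /\ has_dim R^o n.

Definition cohen_macaulay m := cohen_macaulay_module m R^o.

Definition injective_module (E : lmodType R) :=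
  forall (M N : lmodType R) (i : {linear M -> N}) (g : {linear M -> E}),
    injective i -> exists h : {linear N -> E}, forall x, h (i x) = g x.

Definition exact_at (M1 M2 M3 : lmodType R)
    (g : {linear M1 -> M2}) (h : {linear M2 -> M3}) :=
  forall y : M2, h y = 0 <-> exists x : M1, y = g x.

Definition injective_resolution M (E : nat -> lmodType R)
    (e : {linear M -> E 0%N}) (d : forall n, {linear E n -> E n.+1}) :=
  [/\ forall n, injective_module (E n),
      injective e,
      exact_at e (d 0%N) &
      forall n, exact_at (d n) (d n.+1)].

Definition finite_inj_dim M :=
  exists (E : nat -> lmodType R) (e : {linear M -> E 0%N})
         (d : forall n, {linear E n -> E n.+1}),
    injective_resolution e d /\
    exists n, forall i, (n < i)%N -> forall x : E i, x = 0.

(* Ext^n(N, M) is the n-th cohomology of the complex Hom(N, E), where E is an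
   injective resolution of M. *)
Section Ext.
Variables (N : lmodType R) (E : nat -> lmodType R).
Variable d : forall n, {linear E n -> E n.+1}.

Definition ext_cocycle n (g : N -> E n) := forall x, d n (g x) = 0.

Definition ext_coboundary n : (N -> E n) -> Prop :=
  match n return (N -> E n) -> Prop with
  | 0 => fun g => forall x, g x = 0
  | n'.+1 => fun g => exists h : {linear N -> E n'}, forall x, g x = d n' (h x)
  end.

End Ext.

(* dim_k Ext^n(k, M) = r, where k = R / m: the classes of z_0, ..., z_(r-1)
   form a basis of Ext^n(k, M) over k.  Scalars in k are represented by
   elements of R, and vanish in k when they lie in m. *)
Definition ext_residue_dim m M (n r : nat) :=
  exists (E : nat -> lmodType R) (e : {linear M -> E 0%N})
         (d : forall n, {linear E n -> E n.+1}),
    injective_resolution e d /\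
    exists z : 'I_r -> {linear (quot_mod m) -> E n},
      [/\ forall i, ext_cocycle d (z i),
          forall g : {linear (quot_mod m) -> E n}, ext_cocycle d g ->
            exists c : 'I_r -> R,
              ext_coboundary d (fun x => g x - \sum_i c i *: z i x) &
          forall c : 'I_r -> R,
            ext_coboundary d (fun x => \sum_i c i *: z i x) ->
            forall i, c i \in submod_pred m].

Definition has_type m M (r : nat) :=
  exists2 t, has_depth m M t & ext_residue_dim m M t r.

(* Meaningful for R Noetherian, Cohen-Macaulay and local at m. *)
Definition canonical_module m M :=
  [/\ maximal_cohen_macaulay m M, has_type m M 1 & finite_inj_dim M].

Definition gorenstein :=
  [/\ noetherian, exists m, local_at m & finite_inj_dim R^o].

End ModuleTheory.

Arguments noetherian : clear implicits.
Arguments gorenstein : clear implicits.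

Section Amalgamation.
Variables (A B : comPzRingType) (f : {rmorphism A -> B}) (J : ideal B).

Definition amalg_pred : {pred A * B} :=
  fun x => x.2 - f x.1 \in submod_pred J.

Lemma amalg_predE (x : A * B) :
  (x \in amalg_pred) = (x.2 - f x.1 \in submod_pred J).
Proof. by []. Qed.

Lemma amalg_predP (x : A * B) :
  x \in amalg_pred <->
  exists a j, j \in submod_pred J /\ x = (a, f a + j).
Proof.
split=> [xJ|[a [j [jJ ->]]]]; last by rewrite amalg_predE /= addrC addKr.
exists x.1, (x.2 - f x.1); split=> //.
by case: x {xJ} => a b /=; rewrite addrC subrK.
Qed.

Fact amalg_subring_closed : subring_closed amalg_pred.
Proof.
split=> [|x y|x y].
- by rewrite amalg_predE /= rmorph1 subrr ideal0.
- rewrite !amalg_predE /= => xJ yJ; rewrite rmorphB /=.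
  rewrite [X in X \in _](_ : _ = (x.2 - f x.1) - (y.2 - f y.1)) ; first exact: idealB.
  by rewrite !opprD !opprK addrACA.
- rewrite !amalg_predE /= => xJ yJ; rewrite rmorphM /=.
  rewrite [X in X \in _](_ : _ = x.2 * (y.2 - f y.1) + f y.1 * (x.2 - f x.1)).
    by apply: idealD; apply: idealM.
  by rewrite !mulrBr [f y.1 * x.2]mulrC [f y.1 * _]mulrC addrA subrK.
Qed.

HB.instance Definition _ :=
  GRing.isSubringClosed.Build (A * B)%type amalg_pred amalg_subring_closed.

Record amalgamation := Amalgamation {
  amalg_val : A * B;
  amalg_valP : amalg_val \in amalg_pred
}.

HB.instance Definition _ := [isSub for amalg_val].
HB.instance Definition _ := [Choice of amalgamation by <:].
HB.instance Definition _ :=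
  GRing.SubChoice_isSubComPzRing.Build (A * B)%type amalg_pred amalgamation
    amalg_subring_closed.

Fact preim_submod_closed :
  submod_closed (fun a : A^o => f a \in submod_pred J).
Proof.
split=> [|c x y xJ yJ]; first by rewrite -topredE /= rmorph0 ideal0.
rewrite -topredE /= rmorphD rmorphM idealD //.
exact: idealM.
Qed.

Definition preim_ideal : ideal A := Submodule preim_submod_closed.

Definition fin_gen_via :=
  exists (n : nat) (v : 'I_n -> B),
    (forall i, v i \in submod_pred J) /\
    forall x, x \in submod_pred J ->
      exists c : 'I_n -> A, x = \sum_i f (c i) * v i.

Definition in_image_plus (x : B) :=
  exists a j, j \in submod_pred J /\ x = f a + j.

Definition in_annihilator (x : B) :=
  in_image_plus x /\ forall j, j \in submod_pred J -> x * j = 0.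

End Amalgamation.

(* Main.v *)
Require Import Defs.
From HB Require Import structures.
From mathcomp Require Import all_boot all_algebra.
From mathcomp Require Import boolp ring.

(** Let R be the amalgamation.  It contains A through a |-> (a, f(a)) and
    retracts onto A, with kernel {0} x J, and it is finite over A.  Since
    Ann(J) = 0, the ideal f^-1(J) is the annihilator of this kernel, that is
    K = Hom_R(A, R).  So the statement is an instance of the fact that for a
    Gorenstein local ring R, finite over a Cohen-Macaulay retract A, the module
    Hom_R(A, R) is canonical (retract_canonical).

    Let E be the given finite injective resolution of R.  Cyclic modules R / I
    suffice, except in the proof of cohomology_fg: Hom_R(R / I, E) is the complex
    of the elements of E killed by I, with cohomology Ext_R(R / I, R).  The predicate acyc says
    that it vanishes in one degree.  Injectivity gives the long exact sequence
    of 0 -> R / (I : x) -> R / I -> R / (I + (x)) -> 0, and dimension shifting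
    shows that the cohomology is finitely generated (cohomology_fg), so that
    Nakayama's lemma applies (acyc_nakayama).

    Let k be the residue field and n = dim A = depth A.  The heart of the proof
    is residue_cohomology: Ext^i_R(k, R) is zero for i <> n, and cyclic and
    nonzero for i = n.  The largest degree r in which it is nonzero bounds the
    nonvanishing of all Ext_R(R / I, R) (acyc_vanishing).  It is at most the
    length of a maximal regular sequence of R, hence at most n, because regular
    sequences yield chains of primes (regular_seq_chain), whose contractions to
    A remain distinct (incomparable).  It is at least n because of a maximal
    regular sequence xs of A, whose quotient A / (xs) contains k.

    From there, Ext^i_R(A / (xs_0, ..., xs_(j-1)), R) is concentrated in degree
    j (xtower_acyc).  For j = 0, this makes Hom_R(A, E) a finite injective
    resolution of K over A.  For every j, the module in degree j is
    K / (xs_0, ..., xs_(j-1)) K; with one more term of xs, degree j becomes the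
    kernel of xs_j on it, so that xs is a regular sequence on K
    (xs_regular_kernel).  Hence K is maximal Cohen-Macaulay, and its type is the
    dimension of Ext^n_A(k, K) = Ext^n_R(k, R), which is 1. *)

Set Implicit Arguments.
Unset Strict Implicit.
Unset Printing Implicit Defensive.

Import GRing.Theory.
Local Open Scope ring_scope.

(** * Submodules and Noetherian induction *)

Lemma in_tail (T : eqType) (x : T) (s : seq T) (Q : T -> Prop) :
  (forall v, v \in x :: s -> Q v) -> forall v, v \in s -> Q v.
Proof. by move=> Qs v vs; apply: Qs; rewrite inE vs orbT. Qed.

Section PropSubmodules.
Variable R : comPzRingType.

Definition is_submod (V : lmodType R) (P : V -> Prop) :=
  P 0 /\ forall a x y, P x -> P y -> P (a *: x + y).

Section Closure.
Variables (V : lmodType R) (P : V -> Prop).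
Hypothesis subP : is_submod P.

Lemma is_submodD x y : P x -> P y -> P (x + y).
Proof. by move=> Px Py; rewrite -[x]scale1r; apply: subP.2. Qed.

Lemma is_submodZ a x : P x -> P (a *: x).
Proof. by move=> Px; rewrite -[_ *: _]addr0; apply: subP.2 => //; case: subP. Qed.

Lemma is_submodN x : P x -> P (- x).
Proof. by move=> Px; rewrite -scaleN1r; apply: is_submodZ. Qed.

Lemma is_submodB x y : P x -> P y -> P (x - y).
Proof. by move=> Px Py; apply: is_submodD => //; apply: is_submodN. Qed.

Lemma is_submod_sum (J : Type) (r : seq J) (F : J -> V) :
  (forall i, P (F i)) -> P (\sum_(i <- r) F i).
Proof.
by move=> PF; apply: big_ind => // [|x y]; [case: subP | apply: is_submodD].
Qed.

Fact mk_submod_closed : submod_closed (fun x : V => `[< P x >]).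
Proof.
split=> [|a x y xP yP]; first by apply/asboolP; case: subP.
by apply/asboolP; apply: subP.2; apply/asboolP.
Qed.

Definition mk_submodule : submodule V := Submodule mk_submod_closed.

Lemma mem_mk_submodule x : (x \in submod_pred mk_submodule) <-> P x.
Proof. by split=> [/asboolP|Px] //; apply/asboolP. Qed.

End Closure.

Lemma submodule_is_submod (V : lmodType R) (N : submodule V) :
  is_submod (fun x => x \in submod_pred N).
Proof. by split=> [|a x y xN yN]; [apply: rpred0 | apply/rpredD/yN/rpredZ]. Qed.

Fixpoint span (V : lmodType R) (l : seq V) (x : V) : Prop :=
  if l is v :: l' then exists c, span l' (x - c *: v) else x = 0.

Lemma span_submod (V : lmodType R) (l : seq V) : is_submod (span l).
Proof.
elim: l => [|v l [IH0 IH]] /=; first by split=> // a x y -> ->; rewrite scaler0 addr0.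
split=> [|a x y [c xc] [c' yc]]; first by exists 0; rewrite scale0r subr0.
exists (a * c + c'); rewrite scalerDl -scalerA opprD addrACA -scalerBr.
exact: IH.
Qed.

Lemma span_sub (V : lmodType R) (P : V -> Prop) (l : seq V) x :
  is_submod P -> (forall v, v \in l -> P v) -> span l x -> P x.
Proof.
move=> subP; elim: l x => [|v l IH] x Pl /=; first by move=> ->; case: subP.
move=> [c xc]; rewrite -[x](subrK (c *: v)); apply: is_submodD => //.
  by apply: IH xc => w wl; apply: Pl; rewrite inE wl orbT.
by apply: is_submodZ => //; apply: Pl; rewrite mem_head.
Qed.

Lemma span_cons (V : lmodType R) v (l : seq V) x : span l x -> span (v :: l) x.
Proof. by exists 0; rewrite scale0r subr0. Qed.

Lemma span_mem (V : lmodType R) (l : seq V) v : v \in l -> span l v.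
Proof.
elim: l => // w l IH; rewrite inE => /orP[/eqP->|vl]; last exact/span_cons/IH.
by exists 1; rewrite scale1r subrr; case: (span_submod l).
Qed.

Lemma span_mono (V : lmodType R) (l l' : seq V) x :
  {subset l <= l'} -> span l x -> span l' x.
Proof.
by move=> ll'; apply: span_sub (span_submod l') _ => v /ll'; apply: span_mem.
Qed.

Lemma span_image (V W : lmodType R) (f : {linear V -> W}) (l : seq V) x :
  span l x -> span (map f l) (f x).
Proof.
elim: l x => [|v l IH] x /=; first by move=> ->; rewrite linear0.
by move=> [c /IH]; rewrite linearB linearZ; exists c.
Qed.

Lemma fin_gen_span (V : lmodType R) :
  fin_gen V -> exists l : seq V, forall x, span l x.
Proof.
move=> [n [v gen]]; exists (codom v) => x; have [c ->] := gen x.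
apply: (is_submod_sum (span_submod _)) => i.
exact/(is_submodZ (span_submod _))/span_mem/codom_f.
Qed.

Definition fg_submod (V : lmodType R) (P : V -> Prop) :=
  exists l : seq V, (forall v, v \in l -> P v) /\ (forall x, P x -> span l x).

Hypothesis noethR : noetherian R.

Lemma fg_ideal (P : R^o -> Prop) : is_submod P -> fg_submod P.
Proof.
move=> subP; have [l gen] := fin_gen_span (noethR (mk_submodule subP)).
exists (map val l); split=> [v /mapP[u _ ->]|x Px].
  exact/(mem_mk_submodule subP)/valP.
have xP : x \in submod_pred (mk_submodule subP) by apply/mem_mk_submodule.
pose incl : {linear submod_of (mk_submodule subP) -> R^o} := \val.
exact: (span_image incl (gen (SubmodOf xP))).
Qed.

(** Induction on the generators: the coefficients of the first one on P form an
    ideal, and what is left lies in the span of the others. *)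
Lemma fg_sub_span (V : lmodType R) (l : seq V) (P : V -> Prop) :
  is_submod P -> (forall x, P x -> span l x) -> fg_submod P.
Proof.
elim: l P => [|v l IH] P subP Pl.
  by exists [::]; split.
pose Q (c : R^o) := exists2 x, P x & span l (x - c *: v).
have subQ : is_submod Q.
  split=> [|a c c' [x Px xl] [y Py yl]].
    exists 0; first by case: subP.
    by rewrite scale0r subr0; case: (span_submod l).
  exists (a *: x + y); first exact: subP.2.
  rewrite scalerDl -scalerA opprD addrACA -scalerBr.
  exact: (span_submod l).2.
have [cs [csQ Qcs]] := fg_ideal subQ.
(* Elements xs of P whose first coefficients are the generators cs of Q. *)
have [xs [xsP xsQ]] : exists xs : seq V, (forall x, x \in xs -> P x) /\
    forall c, span cs c -> exists2 y, span xs y & span l (y - c *: v).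
  elim: cs csQ {Qcs} => [|c1 cs IHc] csQ.
    exists [::]; split=> // c ->; exists 0 => //.
    by rewrite scale0r subr0; case: (span_submod l).
  have [xs [xsP xsQ]] := IHc (in_tail csQ).
  have [x1 Px1 x1l] := csQ c1 (mem_head _ _).
  exists (x1 :: xs); split=> [x|c [a /xsQ[y yxs yl]]].
    by rewrite inE => /orP[/eqP->|/xsP].
  exists (a *: x1 + y); first by exists a; rewrite addrC addKr.
  have -> : a *: x1 + y - c *: v =
      a *: (x1 - c1 *: v) + (y - (c - a *: c1) *: v).
    rewrite scalerBr scalerBl -[(a *: c1) *: v]scalerA opprB.
    by rewrite [y + _]addrCA !addrA subrK.
  exact: (span_submod l).2.
pose P' x := P x /\ span l x.
have subP' : is_submod P'.
  split=> [|a x y [Px xl] [Py yl]]; first by split; [case: subP|case: (span_submod l)].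
  by split; [apply: subP.2 | apply: (span_submod l).2].
have [l' [l'P P'l']] := IH P' subP' (fun x => @proj2 _ _).
exists (xs ++ l'); split=> [x|x Px].
  by rewrite mem_cat => /orP[/xsP|/l'P[]].
have [c xc] := Pl x Px.
have /xsQ[y yxs yl] : span cs c by apply: Qcs; exists x.
rewrite -[x](subrK y) addrC; apply: is_submodD; first exact: span_submod.
  by apply: span_mono yxs => z zxs; rewrite mem_cat zxs.
apply: (@span_mono _ l') => [z zl'|]; first by rewrite mem_cat zl' orbT.
apply: P'l'; split; first by apply: is_submodB => //; apply: span_sub subP xsP yxs.
have -> : x - y = (x - c *: v) - (y - c *: v) by rewrite opprB addrA subrK.
by apply: is_submodB => //; apply: span_submod.
Qed.

(** The union of the chain is finitely generated, so a single stage contains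
    all its generators. *)
Lemma chain_stable (V : lmodType R) (l : seq V) (P : nat -> V -> Prop) :
  (forall x, span l x) -> (forall n, is_submod (P n)) ->
  (forall n x, P n x -> P n.+1 x) ->
  exists N, forall n x, P n x -> P N x.
Proof.
move=> gen subP incP.
have monoP n m x : (n <= m)%N -> P n x -> P m x.
  by move=> /subnK<- Pn; elim: (m - n)%N => // k IHk; apply: incP.
pose U x := exists n, P n x.
have subU : is_submod U.
  split=> [|a x y [n Pn] [m Pm]]; first by exists 0; case: (subP 0).
  exists (maxn n m); apply: (subP _).2.
    exact: monoP (leq_maxl _ _) Pn.
  exact: monoP (leq_maxr _ _) Pm.
have [us [usU Uus]] := fg_sub_span subU (fun x _ => gen x).
suff [N NP] : exists N, forall u, u \in us -> P N u.
  exists N => n x Pn; apply: span_sub (subP N) NP _.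
  by apply: Uus; exists n.
elim: us usU {Uus} => [|u us IH] usU; first by exists 0.
have [N NP] := IH (in_tail usU).
have [n Pn] := usU u (mem_head _ _).
exists (maxn n N) => w; rewrite inE => /orP[/eqP->|/NP PN].
  exact: monoP (leq_maxl _ _) Pn.
exact: monoP (leq_maxr _ _) PN.
Qed.

Lemma span_1 (x : R^o) : span [:: 1 : R^o] x.
Proof. by exists x; rewrite /= [x *: _]mulr1 subrr. Qed.

(** A counterexample would lie strictly inside another one, and choosing such
    ideals forever contradicts chain_stable. *)
Lemma noetherian_ind (F : ideal R -> Prop) :
  (forall I : ideal R,
     (forall L : ideal R, {subset submod_pred I <= submod_pred L} ->
        (exists2 x, x \in submod_pred L & x \notin submod_pred I) -> F L) ->
     F I) ->
  forall I, F I.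
Proof.
move=> indF I0; apply: contrapT => nFI0.
pose bad := {I : ideal R | ~ F I}.
have step (b : bad) : exists b' : bad,
    {subset submod_pred (sval b) <= submod_pred (sval b')} /\
    exists2 x, x \in submod_pred (sval b') & x \notin submod_pred (sval b).
  apply: contrapT => nob; apply: (svalP b); apply: indF => L IL xL.
  by apply: contrapT => nFL; apply: nob; exists (exist _ L nFL).
have [next nextP] := choice step.
pose chain n := iter n next (exist _ I0 nFI0).
pose P n (x : R^o) : Prop := x \in submod_pred (sval (chain n)).
have [||N NP] := @chain_stable R^o _ P span_1.
- by move=> n; apply: submodule_is_submod.
- by move=> n x; apply: (nextP (chain n)).1.
have [_ [x xL xI]] := nextP (chain N).
by move: xI; rewrite (NP N.+1 x).
Qed.

(** Otherwise elements of T could be added forever, each of them outside the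
    span of the previous ones. *)
Lemma span_finite (V : lmodType R) (l : seq V) (T : V -> Prop) :
  (forall x, span l x) ->
  exists ts : seq V, (forall t, t \in ts -> T t) /\ forall t, T t -> span ts t.
Proof.
move=> gen; apply: contrapT => none.
pose fam := {ts : seq V | forall t, t \in ts -> T t}.
have step (ts : fam) : exists ts' : fam,
    exists t, sval ts' = t :: sval ts /\ ~ span (sval ts) t.
  case: ts => ts tsT; apply: contrapT => nots; apply: none.
  exists ts; split=> // t Tt; apply: contrapT => nt; apply: nots.
  have tts u : u \in t :: ts -> T u by rewrite inE => /orP[/eqP->|/tsT].
  by exists (exist _ _ tts), t.
have [next nextP] := choice step.
have nilT t : t \in [::] -> T t by [].
pose chain n := iter n next (exist _ _ nilT : fam).
have [||N NP] := @chain_stable _ _ (fun n => span (sval (chain n))) gen.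
- by move=> n; apply: span_submod.
- by move=> n x; have [t [/= -> _]] := nextP (chain n); apply: span_cons.
have [t [eqt nt]] := nextP (chain N); apply/nt/(NP N.+1).
by rewrite /= eqt; apply: span_mem; rewrite mem_head.
Qed.

End PropSubmodules.

(** * Ideals and primes of a Noetherian ring *)

Section Ideals.
Variable R : comPzRingType.
Implicit Types (I L P Q : ideal R) (a b c s v x : R).

Fact colon_closed I x : is_submod (fun a : R^o => (a : R) * x \in submod_pred I).
Proof.
split=> [|c a b aI bI]; first by rewrite mul0r ideal0.
by rewrite mulrDl -mulrA idealD // idealM.
Qed.
Definition colon I x : ideal R := mk_submodule (colon_closed I x).

Lemma mem_colon I x a : (a \in submod_pred (colon I x)) <-> a * x \in submod_pred I.
Proof. exact: (mem_mk_submodule (colon_closed I x)). Qed.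

Fact addI_closed I x :
  is_submod (fun a : R^o => exists c, (a : R) - c * x \in submod_pred I).
Proof.
split=> [|d a b [c cI] [c' c'I]]; first by exists 0; rewrite mul0r subr0 ideal0.
exists (d * c + c').
suff -> : (d * a + b) - (d * c + c') * x = d * (a - c * x) + (b - c' * x).
  by rewrite idealD // idealM.
by ring.
Qed.
Definition addI I x : ideal R := mk_submodule (addI_closed I x).

Lemma mem_addI I x a :
  (a \in submod_pred (addI I x)) <-> exists c, a - c * x \in submod_pred I.
Proof. exact: (mem_mk_submodule (addI_closed I x)). Qed.

Lemma sub_addI I x : {subset submod_pred I <= submod_pred (addI I x)}.
Proof. by move=> a aI; apply/mem_addI; exists 0; rewrite mul0r subr0. Qed.

Lemma addI_mem I x : x \in submod_pred (addI I x).
Proof. by apply/mem_addI; exists 1; rewrite mul1r subrr ideal0. Qed.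

Lemma sub_colon I x : {subset submod_pred I <= submod_pred (colon I x)}.
Proof. by move=> a aI; apply/mem_colon; rewrite mulrC idealM. Qed.

Fact zeroI_closed : is_submod (fun a : R^o => a = 0).
Proof. by split=> // a x y -> ->; rewrite scaler0 addr0. Qed.
Definition zeroI : ideal R := mk_submodule zeroI_closed.

Lemma mem_zeroI a : (a \in submod_pred zeroI) <-> a = 0.
Proof. exact: (mem_mk_submodule (zeroI_closed)). Qed.

Hypothesis noethR : noetherian R.

(** An ideal maximal among those disjoint from a multiplicative set is prime. *)
Lemma prime_avoiding (S : R -> Prop) L :
  S 1 -> (forall a b, S a -> S b -> S (a * b)) ->
  (forall a, a \in submod_pred L -> ~ S a) ->
  exists Q, [/\ prime_ideal Q, {subset submod_pred L <= submod_pred Q} &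
               forall a, a \in submod_pred Q -> ~ S a].
Proof.
move=> S1 SM; elim/(noetherian_ind noethR): L => L IH LS.
have [[a [aL aS]]|noa] := EM (exists a, a \notin submod_pred L /\
    forall b, b \in submod_pred (addI L a) -> ~ S b).
  have [|Q [Qp LQ QS]] := IH _ (@sub_addI L a) _ aS.
    by exists a; rewrite // addI_mem.
  by exists Q; split=> // b bL; apply/LQ/sub_addI.
have meets a : a \notin submod_pred L ->
    exists c s, S s /\ s - c * a \in submod_pred L.
  move=> aL; apply: contrapT => nocs; apply: noa; exists a; split=> // b.
  by move=> /mem_addI[c bcL] Sb; apply: nocs; exists c, b.
exists L; split=> //; split=> [|a b abL]; first by apply/negP=> /LS.
apply: contrapT => /not_orP[/negP/meets[c [s [Ss sc]]] /negP/meets[c' [s' [Ss' sc']]]].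
apply: (LS (s * s')); last exact: SM.
have -> : s * s' = s' * (s - c * a) + (c * a * (s' - c' * b) + c * c' * (a * b)).
  by ring.
by apply: idealD; [|apply: idealD]; apply: idealM.
Qed.

(** The products s^n * c with c outside P form a multiplicative set, and a prime
    avoiding them lies in P and misses s.  They avoid L when L lies in P and s
    is a nonzerodivisor modulo L: such an s lowers the dimension. *)
Lemma prime_below P L s :
  prime_ideal P ->
  (forall n c, c \notin submod_pred P -> s ^+ n * c \notin submod_pred L) ->
  exists Q, [/\ prime_ideal Q, {subset submod_pred L <= submod_pred Q},
               {subset submod_pred Q <= submod_pred P} &
               s \notin submod_pred Q].
Proof.
move=> [P1 PM] sL.
pose S a := exists n c, c \notin submod_pred P /\ a = s ^+ n * c.
have S1 : S 1 by exists 0%N, 1; rewrite expr0 mul1r.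
have SM a b : S a -> S b -> S (a * b).
  move=> [n [c [cP ->]]] [n' [c' [c'P ->]]]; exists (n + n')%N, (c * c').
  split; last by rewrite exprD; ring.
  by apply/negP => /PM[cP'|cP']; [move: cP | move: c'P]; rewrite cP'.
have [|Q [Qp LQ QS]] := prime_avoiding S1 SM (L := L).
  by move=> a aL [n [c [/(sL n) nL ea]]]; move: nL; rewrite -ea aL.
exists Q; split=> // [a aQ|].
  by apply: contrapT => /negP aP; apply: (QS a aQ); exists 0%N, a; rewrite expr0 mul1r.
by apply/negP => /QS; apply; exists 1%N, 1; rewrite expr1 mulr1.
Qed.

Lemma proper_sub_maximal I : proper_id I ->
  exists2 m, maximal_ideal m & {subset submod_pred I <= submod_pred m}.
Proof.
elim/(noetherian_ind noethR): I => I IH I1.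
have [Imax|nmax] := EM (maximal_ideal I); first by exists I.
have [L [IL L1 nLI]] : exists L, [/\ {subset submod_pred I <= submod_pred L},
    proper_id L & ~ (submod_pred L =i submod_pred I)].
  apply: contrapT => noL; apply: nmax; split=> // L IL L1.
  by apply: contrapT => nLI; apply: noL; exists L.
have [|m mmax Lm] := IH L IL _ L1; last by exists m => // a /IL/Lm.
apply: contrapT => nox; apply: nLI => x; apply/idP/idP => [xL|/IL //].
by apply: contrapT => /negP xI; apply: nox; exists x.
Qed.

Section Local.
Variable m : ideal R.
Hypothesis localm : local_at m.

Lemma local_sub I : proper_id I -> {subset submod_pred I <= submod_pred m}.
Proof.
by move=> /proper_sub_maximal[m' /localm.2 mm' Im'] x /Im'; rewrite mm'.
Qed.

Lemma local_unit a : a \notin submod_pred m -> exists b, b * a = 1.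
Proof.
move=> am; apply: contrapT => nob.
have /local_sub : proper_id (addI zeroI a).
  apply/negP => /mem_addI[c /mem_zeroI/eqP]; rewrite subr_eq0 => /eqP ca.
  by apply: nob; exists c.
by move=> /(_ a (addI_mem _ _)); apply/negP.
Qed.

Lemma local_proper : 1 \notin submod_pred m.
Proof. by have [[]] := localm. Qed.

Lemma local_unit1B x c : x \in submod_pred m -> exists b, b * (1 - x * c) = 1.
Proof.
move=> xm; apply: local_unit; apply/negP => x1.
move/negP: local_proper; apply; rewrite -[X in X \in _](subrK (x * c)).
by apply: idealD => //; rewrite mulrC; apply: idealM.
Qed.

Lemma local_prime : prime_ideal m.
Proof.
split=> [|a b abm]; first exact: local_proper.
have [am|/negP/local_unit[a' a'a]] := EM (a \in submod_pred m); first by left.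
by right; rewrite -[b]mul1r -a'a -mulrA idealM.
Qed.

End Local.

(** ** Prime avoidance *)

(** v is maximal modulo I when the ideal (I : v) is maximal among the proper
    ideals of this form; these ideals are then prime. *)
Definition max_colon I v :=
  v \notin submod_pred I /\
  forall w, w \notin submod_pred I ->
    {subset submod_pred (colon I v) <= submod_pred (colon I w)} ->
    {subset submod_pred (colon I w) <= submod_pred (colon I v)}.

Lemma sub_max_colon I v : v \notin submod_pred I ->
  exists2 w, max_colon I w &
    {subset submod_pred (colon I v) <= submod_pred (colon I w)}.
Proof.
move: {-2}(colon I v) (erefl (colon I v)) => L; move: L v.
elim/(noetherian_ind noethR) => L IH v eL vI.
have [vmax|nmax] := EM (max_colon I v); first by exists v => //; rewrite eL.
have [w [wI vw nwv]] : exists w, [/\ w \notin submod_pred I,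
    {subset submod_pred (colon I v) <= submod_pred (colon I w)} &
    ~ {subset submod_pred (colon I w) <= submod_pred (colon I v)}].
  apply: contrapT => now; apply: nmax; split=> // w wI vw.
  by apply: contrapT => nwv; apply: now; exists w.
have [||||u umax wu] := IH (colon I w) _ _ w => //; rewrite eL //.
  apply: contrapT => nox; apply: nwv => x xw; apply: contrapT => /negP xv.
  by apply: nox; exists x.
by exists u => // x /vw/wu.
Qed.

Lemma max_colon_prime I v : max_colon I v -> prime_ideal (colon I v).
Proof.
move=> [vI vmax]; split=> [|a b abv].
  by apply/negP => /mem_colon; rewrite mul1r; apply/negP.
have [bv|/negP bv] := EM (b \in submod_pred (colon I v)); first by right.
left; apply: (vmax (b * v)).
- by apply/negP => bvI; move/negP: bv; apply; apply/mem_colon.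
- by move=> c /mem_colon cv; apply/mem_colon; rewrite mulrCA; apply: idealM.
- by apply/mem_colon; rewrite mulrA; apply/mem_colon.
Qed.

Lemma prime_colon_inter I P (l : seq R) :
  prime_ideal P ->
  (forall v, v \in l -> ~ {subset submod_pred (colon I v) <= submod_pred P}) ->
  exists2 a, a \notin submod_pred P & forall v, v \in l -> a * v \in submod_pred I.
Proof.
move=> [P1 PM]; elim: l => [|v l IH] nP; first by exists 1.
have [a aP al] := IH (in_tail nP).
have [b bv bP] : exists2 b, b \in submod_pred (colon I v) & b \notin submod_pred P.
  apply: contrapT => nob; apply: (nP v (mem_head _ _)) => b bv.
  by apply: contrapT => /negP bP; apply: nob; exists b.
exists (a * b).
  by apply/negP => /PM[|]; apply/negP.
move=> w; rewrite inE => /orP[/eqP->|wl].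
  by rewrite -mulrA; apply: idealM; apply/mem_colon.
by rewrite mulrAC mulrC; apply/idealM/al.
Qed.

(** Prime avoidance: an x that misses the ideals (I : v) for the v in the tail
    of the list is corrected, if it lies in the first one, by an element of m
    that lies in all of them but the first. *)
Lemma colon_avoidance I (m : ideal R) (l : seq R) :
  (forall v, (forall a, a \in submod_pred m -> a * v \in submod_pred I) ->
     v \in submod_pred I) ->
  (forall v, v \in l -> max_colon I v) ->
  exists2 x, x \in submod_pred m & forall v, v \in l -> x * v \notin submod_pred I.
Proof.
move=> socle0; elim: l => [|v l IH] lmax; first by exists 0 => //; apply: ideal0.
have [x xm xl] := IH (in_tail lmax).
have vmax := lmax v (mem_head _ _).
have [xv|/negP xv] := EM (x * v \in submod_pred I); last first.
  by exists x => // w; rewrite inE => /orP[/eqP->|/xl].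
have [P1 PM] := max_colon_prime vmax.
have [|a aP al] := @prime_colon_inter I (colon I v) l (conj P1 PM).
  move=> w wl wv; have wmax := in_tail lmax wl.
  have /mem_colon : x \in submod_pred (colon I w).
    by apply: wmax.2 wv _ _; [case: vmax | apply/mem_colon].
  by apply/negP/xl.
have [b bm bv] : exists2 b, b \in submod_pred m & b * v \notin submod_pred I.
  apply: contrapT => nob; move/negP: vmax.1; apply; apply: socle0 => b bm.
  by apply: contrapT => /negP bv; apply: nob; exists b.
exists (x + a * b); first by apply: idealD => //; apply: idealM.
move=> w; rewrite inE => /orP[/eqP->|wl]; apply/negP.
  rewrite mulrDl => xab.
  have /mem_colon/PM[|/mem_colon] : a * b * v \in submod_pred I.
    by rewrite -[X in X \in _](addKr (x * v)) addrC; apply: idealB.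
  - exact/negP.
  - exact/negP.
rewrite mulrDl => xab; move/negP: (xl w wl); apply.
rewrite -[X in X \in _](addrK (a * b * w)); apply: idealB => //.
by rewrite mulrAC mulrC; apply/idealM/al.
Qed.

(** Every zerodivisor on R / I lies in a maximal ideal of the form (I : v).
    These ideals are finitely many, because finitely many such v span all of
    them, so that prime avoidance applies. *)
Lemma regular_or_socle I (m : ideal R) :
  (forall x, x \in submod_pred m ->
     exists2 v, v \notin submod_pred I & x * v \in submod_pred I) ->
  exists2 v, v \notin submod_pred I &
    forall a, a \in submod_pred m -> a * v \in submod_pred I.
Proof.
move=> zdiv; apply: contrapT => nov.
have socle0 v : (forall a, a \in submod_pred m -> a * v \in submod_pred I) ->
    v \in submod_pred I.
  by move=> mv; apply: contrapT => /negP vI; apply: nov; exists v.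
have [l [lmax maxl]] := @span_finite R noethR R^o _ (max_colon I) (@span_1 R).
have [x xm xl] := colon_avoidance socle0 lmax.
have [v vI xv] := zdiv x xm.
have [w wmax vw] := sub_max_colon vI.
have [u ul uw] : exists2 u, u \in l &
    {subset submod_pred (colon I u) <= submod_pred (colon I w)}.
  apply: contrapT => nou.
  have [u ul uw|a aP al] := @prime_colon_inter I _ l (max_colon_prime wmax).
    by apply: nou; exists u.
  move/negP: aP; apply; apply/mem_colon.
  apply: (span_sub (P := fun w : R^o => a * (w : R) \in submod_pred I)) (maxl w wmax).
    split=> [|c y z yI zI]; first by rewrite mulr0; apply: ideal0.
    by rewrite mulrDr; apply: idealD => //; rewrite mulrCA; apply: idealM.
  exact: al.
move/negP: (xl u ul); apply; apply/mem_colon.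
apply: (lmax u ul).2 uw _ _; first by case: wmax.
by apply/vw/mem_colon.
Qed.

End Ideals.

(** * Regular sequences and chains of primes *)

Section RegularSequences.
Variables (R : comPzRingType) (M : lmodType R).
Implicit Types (s : seq R) (y z : M) (a x : R).

Lemma in_seq_mul_nil y : in_seq_mul [::] y <-> y = 0.
Proof.
split=> [[u ->]|->]; first by rewrite big_ord0.
by exists (fun=> 0); rewrite big_ord0.
Qed.

Lemma in_seq_mul_cons a s y :
  in_seq_mul (a :: s) y <-> exists u, in_seq_mul s (y - a *: u).
Proof.
split=> [[u ->]|[u [w e]]].
  exists (u ord0); exists (fun i => u (lift ord0 i)).
  by rewrite big_ord_recl /= addrC addKr.
exists (fun i => if unlift ord0 i is Some j then w j else u).
rewrite big_ord_recl /= unlift_none -[LHS](subrK (a *: u)) e addrC.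
by congr (_ + _); apply: eq_bigr => i _; rewrite liftK.
Qed.

Lemma in_seq_mul_submod s : is_submod (@in_seq_mul R M s).
Proof.
split=> [|c y z [u ->] [w ->]].
  by exists (fun=> 0); rewrite big1 // => i _; rewrite scaler0.
exists (fun i => c *: u i + w i); rewrite scaler_sumr -big_split /=.
by apply: eq_bigr => i _; rewrite scalerDr !scalerA mulrC.
Qed.

Lemma in_seq_mul_rcons s a y :
  in_seq_mul (rcons s a) y <-> exists u, in_seq_mul s (y - a *: u).
Proof.
elim: s y => [|b s IH] y /=; first by rewrite in_seq_mul_cons.
rewrite in_seq_mul_cons; split=> [[u /IH[w e]]|[u /in_seq_mul_cons[w e]]].
  by exists w; apply/in_seq_mul_cons; exists u; rewrite addrAC.
by exists w; apply/IH; exists u; rewrite addrAC.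
Qed.

Lemma in_seq_mul_take s k y : (k < size s)%N ->
  in_seq_mul (take k.+1 s) y <-> exists u, in_seq_mul (take k s) (y - s`_k *: u).
Proof. by move=> ks; rewrite (take_nth 0) // in_seq_mul_rcons. Qed.

Hypothesis noethR : noetherian R.

(** A chain is built downwards from a prime P containing the annihilator of the
    class of y modulo (s_0, ..., s_(k-1)) M.  Dropping s_(k-1) puts this element
    outside a smaller prime, by prime_below, since it is a nonzerodivisor
    modulo the shorter sequence. *)
Lemma regular_prime_chain s y k (P : ideal R) :
  (forall i, (i < size s)%N -> forall z,
     in_seq_mul (take i s) (s`_i *: z) -> in_seq_mul (take i s) z) ->
  (k <= size s)%N -> prime_ideal P ->
  (forall a, in_seq_mul (take k s) (a *: y) -> a \in submod_pred P) ->
  exists p, prime_chain M k p /\ p k = P.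
Proof.
move=> reg; elim: k P => [|k IH] P ks Pp yP.
  exists (fun=> P); split=> //; split=> // a a0; apply: yP.
  by rewrite take0 a0; apply/in_seq_mul_nil.
have subL : is_submod (fun a : R^o => in_seq_mul (take k s) ((a : R) *: y)).
  split=> [|c a b aL bL]; first by rewrite scale0r; apply: (in_seq_mul_submod _).1.
  by rewrite scalerDl -scalerA; apply: (in_seq_mul_submod _).2.
have [|Q [Qp LQ QP sQ]] := prime_below noethR (L := mk_submodule subL) (s := s`_k) Pp.
  move=> n c cP; apply/negP => /(mem_mk_submodule subL) cL.
  move/negP: cP; apply; apply: yP; apply/in_seq_mul_take => //; exists 0.
  rewrite scaler0 subr0; elim: n cL => [|n IHn]; first by rewrite expr0 mul1r.
  by rewrite exprS -mulrA -scalerA => /(reg k ks).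
have [|p [[pp pA pinc] pk]] := IH Q (ltnW ks) Qp.
  by move=> a aL; apply/LQ/(mem_mk_submodule subL).
exists (fun i => if (i <= k)%N then p i else P); rewrite ltnn; split=> //; split.
- by move=> i _; case: (leqP i k) => [/pp|].
- exact: pA.
- move=> i; rewrite ltnS; case: (ltngtP i k) => // [ik _|-> _].
    exact: pinc.
  rewrite pk; split=> //; exists s`_k => //.
  apply: yP; apply/in_seq_mul_take => //; exists y.
  by rewrite subrr; apply: (in_seq_mul_submod _).1.
Qed.

Variable m : ideal R.
Hypothesis localm : local_at m.

Lemma prime_chain_regular n p : prime_chain M n p -> prime_chain R^o n p.
Proof.
move=> [pp _ pinc]; split=> // a /(_ 1); rewrite [a *: _]mulr1 => ->.
exact: ideal0.
Qed.

Lemma regular_seq_chain s : regular_seq M s -> exists p, prime_chain M (size s) p.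
Proof.
move=> [reg [y ys]].
have subL : is_submod (fun a : R^o => in_seq_mul s ((a : R) *: y)).
  split=> [|c a b aL bL]; first by rewrite scale0r; apply: (in_seq_mul_submod _).1.
  by rewrite scalerDl -scalerA; apply: (in_seq_mul_submod _).2.
have [|p [pp _]] := @regular_prime_chain s y _ _ reg (leqnn _) (local_prime noethR localm).
  move=> a; rewrite take_size => aL.
  apply: (local_sub noethR localm (I := mk_submodule subL)).
    by apply/negP => /(mem_mk_submodule subL); rewrite scale1r.
  exact/(mem_mk_submodule subL).
by exists p.
Qed.

End RegularSequences.

Section MaximalRegularSequences.
Variables (R : comPzRingType) (m : ideal R).
Hypotheses (noethR : noetherian R) (localm : local_at m).

Definition seqI (s : seq R) : ideal R := mk_submodule (@in_seq_mul_submod R R^o s).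

Lemma mem_seqI s a : (a \in submod_pred (seqI s)) <-> @in_seq_mul R R^o s a.
Proof. exact: (mem_mk_submodule (@in_seq_mul_submod R R^o s)). Qed.

Lemma in_seq_mul_ideal (s : seq R) (a : R^o) :
  {subset s <= submod_pred m} -> in_seq_mul s a -> a \in submod_pred m.
Proof.
move=> sm [u ->]; apply: rpred_sum => i _; rewrite [_ *: _]mulrC.
by apply/idealM/sm/mem_nth.
Qed.

(** By regular_or_socle, m would otherwise contain a nonzerodivisor modulo s,
    which would prolong s. *)
Lemma max_regular_socle (s : seq R) :
  {subset s <= submod_pred m} -> regular_seq R^o s ->
  (forall s', {subset s' <= submod_pred m} -> regular_seq R^o s' ->
     (size s' <= size s)%N) ->
  exists2 v, v \notin submod_pred (seqI s) &
    forall a, a \in submod_pred m -> a * v \in submod_pred (seqI s).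
Proof.
move=> sm [reg _] maxs; apply: (regular_or_socle noethR) => x xm.
apply: contrapT => nov.
have sxm : {subset rcons s x <= submod_pred m}.
  by move=> a; rewrite mem_rcons inE => /orP[/eqP->|/sm].
suff /(maxs _ sxm) : regular_seq R^o (rcons s x) by rewrite size_rcons ltnn.
split=> [i|]; last first.
  exists 1 => /(in_seq_mul_ideal sxm); apply/negP.
  exact: local_proper localm.
rewrite size_rcons ltnS leq_eqVlt => /orP[/eqP->|si] y.
  rewrite -cats1 take_size_cat // nth_cat ltnn subnn /= => /mem_seqI xy.
  apply/mem_seqI; apply: contrapT => /negP ys; apply: nov.
  by exists y.
rewrite -cats1 nth_cat si takel_cat; last exact: ltnW.
exact: reg.
Qed.

End MaximalRegularSequences.

(** * Restriction of scalars and integrality *)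

Definition restr (A R : comPzRingType) (h : {rmorphism A -> R}) (V : lmodType R) :
  Type := V.

Section RestrictionOfScalars.
Variables (A R : comPzRingType) (h : {rmorphism A -> R}) (V : lmodType R).

HB.instance Definition _ := GRing.Zmodule.copy (restr h V) (GRing.Lmodule.sort V).

Definition restr_scale (a : A) (x : restr h V) : restr h V := h a *: (x : V).

Fact restr_scaleA a b x : restr_scale a (restr_scale b x) = restr_scale (a * b) x.
Proof. by rewrite /restr_scale scalerA rmorphM. Qed.

Fact restr_scale1 : left_id 1 restr_scale.
Proof. by move=> x; rewrite /restr_scale rmorph1 scale1r. Qed.

Fact restr_scaleDr : right_distributive restr_scale +%R.
Proof. by move=> a x y; rewrite /restr_scale -scalerDr. Qed.

Fact restr_scaleDl x : {morph restr_scale^~ x : a b / a + b}.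
Proof. by move=> a b; rewrite /restr_scale rmorphD scalerDl. Qed.

HB.instance Definition _ := GRing.Zmodule_isLmodule.Build A (restr h V)
  restr_scaleA restr_scale1 restr_scaleDr restr_scaleDl.

Lemma restrZ (a : A) (x : restr h V) : a *: x = h a *: (x : V) :> V.
Proof. by []. Qed.

End RestrictionOfScalars.

Section Integrality.
Variables (A R : comPzRingType) (h : {rmorphism A -> R}).
Hypotheses (noethA : noetherian A) (finR : fin_gen (restr h R^o)).

Fixpoint pow_comb (x : R) (n : nat) (y : R) : Prop :=
  if n is n'.+1 then exists c y', pow_comb x n' y' /\ y = h c + x * y' else y = 0.

Lemma pow_comb_submod x n : is_submod (pow_comb x n : restr h R^o -> Prop).
Proof.
elim: n => [|n [IH0 IH]]; first by split=> // a y z -> ->; rewrite scaler0 addr0.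
split=> [|a y z [c [y' [yn ->]]] [c' [z' [zn ->]]]].
  by exists 0, 0; rewrite rmorph0 mulr0 addr0.
exists (a * c + c'), (h a * y' + z'); split; first exact: (IH a y' z').
rewrite rmorphD rmorphM.
suff -> : (a *: (h c + x * y' : restr h R^o) + (h c' + x * z')) =
  h a * (h c + x * y') + (h c' + x * z') :> R by ring.
by [].
Qed.

Lemma pow_combS x n y : pow_comb x n y -> pow_comb x n.+1 y.
Proof.
elim: n y => [|n IH] y; first by move=> /= ->; exists 0, 0; rewrite rmorph0 mulr0 addr0.
by move=> [c [y' [/IH yn ->]]]; exists c, y'.
Qed.

Lemma pow_comb_exp x n : pow_comb x n.+1 (x ^+ n).
Proof.
elim: n => [|n IH]; first by exists 1, 0; rewrite rmorph1 mulr0 addr0 expr0.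
by exists 0, (x ^+ n); rewrite rmorph0 add0r exprS.
Qed.

Lemma integral x : exists n, pow_comb x n (x ^+ n).
Proof.
have [l gen] := fin_gen_span finR.
have [N NP] := chain_stable noethA gen (pow_comb_submod x) (@pow_combS x).
by exists N; apply: (NP N.+1); apply: pow_comb_exp.
Qed.

(** The constant term of a relation of integral dependence of x modulo P, of
    least degree, lies in Q but not in P. *)
Lemma incomparable (P Q : ideal R) x :
  prime_ideal P -> {subset submod_pred P <= submod_pred Q} ->
  x \in submod_pred Q -> x \notin submod_pred P ->
  exists2 a, h a \in submod_pred Q & h a \notin submod_pred P.
Proof.
move=> [P1 PM] PQ xQ xP.
have [n xn] := integral x.
have : exists2 y, pow_comb x n y & x ^+ n - y \in submod_pred P.
  by exists (x ^+ n); rewrite ?subrr //; apply: ideal0.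
elim: n {xn} => [|n IH] [y].
  by move=> ->; rewrite expr0 subr0 => P1'; move/negP: P1; case.
move=> [c [y' [y'n ->]]] yP.
have xyP : x * (x ^+ n - y') - h c \in submod_pred P.
  have -> : x * (x ^+ n - y') - h c = x ^+ n.+1 - (h c + x * y') by rewrite exprS; ring.
  exact: yP.
have [cP|/negP cP] := EM (h c \in submod_pred P); last first.
  exists c => //; have -> : h c = (x ^+ n - y') * x - (x * (x ^+ n - y') - h c) by ring.
  by apply: idealB; [apply: idealM | apply: PQ].
have /PM[xP'|?] : x * (x ^+ n - y') \in submod_pred P.
  by rewrite -[X in X \in _](subrK (h c)); apply: idealD.
- by move: xP; rewrite xP'.
- by apply: IH; exists y'.
Qed.

Fact contract_closed (P : ideal R) :
  is_submod (fun a : A^o => h a \in submod_pred P).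
Proof.
split=> [|c a b aP bP]; first by rewrite rmorph0; apply: ideal0.
by rewrite rmorphD rmorphM; apply: idealD => //; apply: idealM.
Qed.
Definition contract (P : ideal R) : ideal A := mk_submodule (contract_closed P).

Lemma mem_contract P a : (a \in submod_pred (contract P)) <-> h a \in submod_pred P.
Proof. exact: (mem_mk_submodule (contract_closed P)). Qed.

Lemma contract_prime P : prime_ideal P -> prime_ideal (contract P).
Proof.
move=> [P1 PM]; split=> [|a b /mem_contract].
  by apply/negP => /mem_contract; rewrite rmorph1; apply/negP.
by rewrite rmorphM => /PM[|] ?; [left|right]; apply/mem_contract.
Qed.

Lemma contract_chain n p :
  prime_chain R^o n p -> prime_chain A^o n (fun i => contract (p i)).
Proof.
move=> [pp _ pinc]; split=> [i /pp|a /(_ 1)|i ik].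
- exact: contract_prime.
- by rewrite [a *: _]mulr1 => ->; apply: ideal0.
have [sub [x x1 x0]] := pinc i ik.
split=> [a /mem_contract/sub|]; first by move=> ?; apply/mem_contract.
have [a a1 a0] := incomparable (pp i (ltnW ik)) sub x1 x0.
by exists a; [apply/mem_contract | apply/negP => /mem_contract; apply/negP].
Qed.

End Integrality.

(** * Nakayama's lemma and injective modules *)

Section Nakayama.
Variables (R : comPzRingType) (m : ideal R).
Hypotheses (noethR : noetherian R) (localm : local_at m).

(** The first generator is, modulo B, x times a combination of the generators;
    since 1 - x * c is invertible, it can be eliminated. *)
Lemma nakayama (V : lmodType R) (Z B : V -> Prop) (l : seq V) (x : R) :
  is_submod Z -> is_submod B -> x \in submod_pred m ->
  (forall g, g \in l -> Z g) ->
  (forall z, Z z -> exists2 y, span l y & B (z - y)) ->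
  (forall z, Z z -> exists2 z', Z z' & B (z - x *: z')) ->
  forall z, Z z -> B z.
Proof.
move=> subZ subB xm; elim: l => [|g l IH] Zl genl divx.
  by move=> z /genl[y ->]; rewrite subr0.
apply: IH => //; first exact: in_tail Zl.
suff [y0 y0l gy0] : exists2 y0, span l y0 & B (g - y0).
  move=> z /genl[y [c yl] zy]; exists ((y - c *: g) + c *: y0).
    exact/(is_submodD (span_submod l) yl)/(is_submodZ (span_submod l)).
  have -> : z - (y - c *: g + c *: y0) = c *: (g - y0) + (z - y).
    by rewrite scalerBr [RHS]addrC !opprD opprK !addrA.
  exact: subB.2.
have [z' /genl[y [c yl] z'y] gz'] := divx g (Zl g (mem_head _ _)).
have [b bx] := local_unit1B noethR localm c xm.
exists ((b * x) *: (y - c *: g)); first exact: (is_submodZ (span_submod l)).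
have -> : g - (b * x) *: (y - c *: g) = b *: (g - x *: z') + (b * x) *: (z' - y).
  rewrite -[X in X - _ = _]scale1r -bx !scalerBr !scalerA mulrBr mulr1 scalerBl.
  by rewrite mulrA opprB !addrA !subrK.
by apply: subB.2 => //; apply: is_submodZ.
Qed.

End Nakayama.

Section Linear.
Variables (R : comPzRingType) (U V : lmodType R) (f : U -> V).
Hypothesis fP : forall a x y, f (a *: x + y) = a *: f x + f y.

Definition mk_linear : {linear U -> V} := HB.pack f (GRing.isLinear.Build R U V *:%R f fP).

End Linear.

Section Injective.
Variables (R : comPzRingType) (E : lmodType R).
Hypothesis injE : injective_module E.

(** Injectivity is applied to the inclusion of the domain of G; with a graph in
    place of a map, neither this domain nor representatives need be chosen when
    the lemma is used. *)
Lemma extend_relation (N : lmodType R) (G : N -> E -> Prop) :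
  G 0 0 ->
  (forall a v w e f, G v e -> G w f -> G (a *: v + w) (a *: e + f)) ->
  (forall e, G 0 e -> e = 0) ->
  exists h : {linear N -> E}, forall v e, G v e -> h v = e.
Proof.
move=> G0 GL Guniq.
have functional v e e' : G v e -> G v e' -> e = e'.
  move=> ve ve'; apply/eqP; rewrite -subr_eq0; apply/eqP/Guniq.
  have := GL (-1) _ _ _ _ ve' ve.
  by rewrite !scaleN1r addNr addrC.
have subD : is_submod (fun v => exists e, G v e).
  by split=> [|a v w [e ve] [f wf]]; [exists 0 | exists (a *: e + f); apply: GL].
have /choice[g gG] (u : submod_of (mk_submodule subD)) : exists e, G (val u) e.
  exact/(mem_mk_submodule subD)/(valP u).
have gP a x y : g (a *: x + y) = a *: g x + g y.
  by apply: functional (gG _) _; apply: GL.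
have valP a (x y : submod_of (mk_submodule subD)) :
  val (a *: x + y) = a *: val x + val y by [].
have [h hg] := injE (i := mk_linear valP) (mk_linear gP) val_inj.
exists h => v e ve.
have vD : v \in submod_pred (mk_submodule subD) by apply/mem_mk_submodule; exists e.
by rewrite -(functional _ _ _ (gG (SubmodOf vD)) ve) -[RHS]hg.
Qed.

End Injective.

Section Torsion.
Variables (R : comPzRingType) (V : lmodType R).
Implicit Types (I L : ideal R) (e u : V).

Definition tors I e := forall a, a \in submod_pred I -> a *: e = 0.

Lemma tors_submod I : is_submod (tors I).
Proof.
split=> [a _|c x y xI yI a aI]; first exact: scaler0.
by rewrite scalerDr scalerA mulrC -scalerA xI // yI // scaler0 addr0.
Qed.

Lemma torsB I e u : tors I e -> tors I u -> tors I (e - u).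
Proof. by move=> eI uI; apply: (is_submodB (@tors_submod I)). Qed.

Lemma tors_sub I L e :
  {subset submod_pred I <= submod_pred L} -> tors L e -> tors I e.
Proof. by move=> IL eL a /IL; apply: eL. Qed.

Lemma tors_addI I x e : tors I e -> x *: e = 0 -> tors (addI I x) e.
Proof.
move=> eI ex a /mem_addI[c ac].
by rewrite -(subrK (c * x) a) scalerDl eI // -scalerA ex scaler0 addr0.
Qed.

Lemma tors_addIl I x e : tors (addI I x) e -> tors I e.
Proof. exact/tors_sub/sub_addI. Qed.

Lemma tors_addIr I x e : tors (addI I x) e -> x *: e = 0.
Proof. by apply; apply: addI_mem. Qed.

Lemma tors_colon I x e : tors I e -> tors (colon I x) (x *: e).
Proof. by move=> eI a /mem_colon ax; rewrite scalerA eI. Qed.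

(** This is the surjectivity of Hom(_, V) applied to the injection
    R / (I : x) -> R / I given by x. *)
Lemma tors_divide I x e :
  injective_module V -> tors (colon I x) e -> exists2 u, tors I u & x *: u = e.
Proof.
move=> injV ex.
pose G (v : R^o) w := exists2 c, v - c * x \in submod_pred I & w = c *: e.
have [|a v w f f' [c vc ->] [c' wc' ->]|f [c c0 ->]|h hG] :=
  @extend_relation _ _ injV R^o G.
- by exists 0; rewrite ?mul0r ?subr0 ?scale0r //; apply: ideal0.
- exists (a * c + c'); last by rewrite scalerDl scalerA.
  have -> : (a *: v + w) - (a * c + c') * x = a * (v - c * x) + (w - c' * x) :> R.
    suff -> : (a *: v + w) = a * v + w :> R by ring.
    by [].
  by apply: idealD => //; apply: idealM.
- apply: ex; apply/mem_colon.
  by move: c0; rewrite sub0r => /(idealM (-1)); rewrite mulN1r opprK.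
have hE (a : R) : a *: h 1 = h a by rewrite -linearZ /= [a *: _]mulr1.
exists (h 1) => [a aI|]; rewrite hE; apply: hG.
  by exists 0; rewrite ?mul0r ?subr0 ?scale0r.
by exists 1; rewrite ?mul1r ?subrr ?scale1r //; apply: ideal0.
Qed.

End Torsion.

(** * Cohomology of the torsion subcomplexes *)

Section Complex.
Variables (R : comPzRingType) (E : nat -> lmodType R).
Variable d : forall n, {linear E n -> E n.+1}.
Hypothesis injE : forall n, injective_module (E n).
Hypothesis dd : forall n x, d n.+1 (d n x) = 0.
Implicit Types (I L : ideal R) (x : R).

Definition cocyc I i (e : E i) := tors I e /\ d i e = 0.

Definition bnd I i : E i -> Prop :=
  match i return E i -> Prop with
  | 0 => fun e => e = 0
  | n.+1 => fun e => exists2 u, tors I u & e = d n u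
  end.

(** The torsion subcomplex has no cohomology in degree i; when E is an
    injective resolution of M, this says that Ext^i(R / I, M) = 0. *)
Definition acyc I i := forall e, cocyc I e -> @bnd I i e.

Definition cyc I i := exists2 g : E i, cocyc I g &
  forall e, cocyc I e -> exists c, bnd I (e - c *: g).

Lemma cocyc_submod I i : is_submod (@cocyc I i).
Proof.
split=> [|c x y [xI dx] [yI dy]].
  by split; [exact: (@tors_submod _ _ I).1 | rewrite linear0].
split; first exact: (@tors_submod _ _ I).2.
by rewrite linearD linearZ /= dx dy scaler0 addr0.
Qed.

Lemma bnd_submod I i : is_submod (@bnd I i).
Proof.
case: i => [|i]; first by split=> // c x y -> ->; rewrite scaler0 addr0.
split=> [|c x y [u uI ->] [w wI ->]].
  by exists 0; rewrite ?linear0 //; exact: (@tors_submod _ _ I).1.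
exists (c *: u + w); first exact: (@tors_submod _ _ I).2.
by rewrite linearD linearZ.
Qed.

Lemma bnd_cocyc I i (e : E i) : bnd I e -> cocyc I e.
Proof.
case: i e => [|i] e; first by move=> ->; exact: (cocyc_submod I 0).1.
by move=> [u uI ->]; split=> // a aI; rewrite -linearZ uI // linear0.
Qed.

Lemma bnd_sub I L i (e : E i) :
  {subset submod_pred I <= submod_pred L} -> bnd L e -> bnd I e.
Proof.
move=> IL; case: i e => // i e [u uL ->]; exists u => //.
exact: tors_sub uL.
Qed.

Lemma acyc_eq I L i : submod_pred I =i submod_pred L -> acyc I i -> acyc L i.
Proof.
move=> IL aI e [eL de]; apply: bnd_sub (aI e _) => [a|]; first by rewrite IL.
by split=> // a; rewrite IL; apply: eL.
Qed.

Lemma cyc_eq I L i : submod_pred I =i submod_pred L -> cyc I i -> cyc L i.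
Proof.
move=> IL [g [gI dg] gen]; exists g => [|e [eL de]].
  by split=> // a; rewrite -IL; apply: gI.
have [|c ec] := gen e; first by split=> // a; rewrite IL; apply: eL.
by exists c; apply: bnd_sub ec => a; rewrite IL.
Qed.

Lemma bnd_colon I x i (e : E i) : bnd I e -> bnd (colon I x) (x *: e).
Proof.
case: i e => [|i] e; first by move=> /= ->; rewrite scaler0.
move=> [u uI ->]; exists (x *: u); last by rewrite linearZ.
exact: tors_colon.
Qed.

Lemma bnd_colon_lift I x i (e : E i) : bnd (colon I x) (x *: e) ->
  exists2 b, bnd I b & x *: (e - b) = 0.
Proof.
case: i e => [|i] e; first by move=> /= e0; exists 0; rewrite ?subr0.
move=> [w wI ew]; have [u uI uw] := tors_divide (@injE _) wI.
exists (d i u); first by exists u.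
by rewrite scalerBr -linearZ /= uw -ew subrr.
Qed.

(** The next lemmas are pieces of the long exact sequence attached to
    0 -> R / (I : x) -> R / I -> R / (I + (x)) -> 0. *)

Lemma acyc_middle I x i :
  acyc (addI I x) i -> acyc (colon I x) i -> acyc I i.
Proof.
move=> aL aC e [eI de].
have /bnd_colon_lift[b bI eb] : bnd (colon I x) (x *: e).
  by apply: aC; split; [apply: tors_colon | rewrite linearZ /= de scaler0].
have [b_tors db] := bnd_cocyc bI.
rewrite -(subrK b e); apply: (is_submodD (@bnd_submod I i)) => //.
apply: bnd_sub (@sub_addI _ I x) _; apply: aL; split.
  by apply: tors_addI => //; apply: torsB.
by rewrite linearB /= de db subr0.
Qed.

Lemma cocyc_divide I x i (w : E i) :
  acyc (addI I x) i.+1 -> cocyc (colon I x) w ->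
  exists2 z, cocyc I z & w = x *: z.
Proof.
move=> aL [wI dw]; have [u uI uw] := tors_divide (@injE _) wI.
have [|b bL db] := aL (d i u).
  split; last exact: dd.
  apply: tors_addI => [a aI|]; first by rewrite -linearZ uI ?linear0.
  by rewrite -linearZ /= uw.
exists (u - b); last by rewrite scalerBr uw (tors_addIr bL) subr0.
split; last by rewrite linearB /= db subrr.
exact: torsB (tors_addIl bL).
Qed.

Lemma acyc_colon I x i : acyc I i -> acyc (addI I x) i.+1 -> acyc (colon I x) i.
Proof.
by move=> aI aL w /(cocyc_divide aL)[z /aI zI ->]; apply: bnd_colon.
Qed.

Lemma cyc_colon I x i : cyc I i -> acyc (addI I x) i.+1 -> cyc (colon I x) i.
Proof.
move=> [g [gI dg] gen] aL; exists (x *: g).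
  by split; [apply: tors_colon | rewrite linearZ /= dg scaler0].
move=> w /(cocyc_divide aL)[z /gen[c zc] ->]; exists c.
by rewrite scalerA mulrC -scalerA -scalerBr; apply: bnd_colon.
Qed.

Lemma bnd_addI I x i (e : E i.+1) :
  acyc (colon I x) i -> cocyc (addI I x) e -> bnd I e -> bnd (addI I x) e.
Proof.
move=> aC [eL de] [u uI eu].
have /bnd_colon_lift[b bI ub] : bnd (colon I x) (x *: u).
  apply: aC; split; first exact: tors_colon.
  by rewrite linearZ /= -eu (tors_addIr eL).
have [b_tors db] := bnd_cocyc bI.
exists (u - b); last by rewrite linearB /= db subr0.
by apply: tors_addI => //; apply: torsB.
Qed.

Lemma acyc_addI I x i :
  acyc I i.+1 -> acyc (colon I x) i -> acyc (addI I x) i.+1.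
Proof.
move=> aI aC e eL; apply: bnd_addI => //; apply: aI.
by case: eL => eL de; split=> //; apply: tors_addIl eL.
Qed.

Lemma acyc0_sub I L : {subset submod_pred I <= submod_pred L} ->
  acyc I 0 -> acyc L 0.
Proof. by move=> IL aI e [eL de]; apply: aI; split=> //; apply: tors_sub eL. Qed.

Lemma cyc_addI I x i :
  acyc I i.+1 -> cyc (colon I x) i -> cyc (addI I x) i.+1.
Proof.
move=> aI [g [gI dg] gen].
have [w wI wg] := tors_divide (@injE _) gI.
exists (d i w).
  split; last exact: dd.
  apply: tors_addI => [a aI'|]; first by rewrite -linearZ wI ?linear0.
  by rewrite -linearZ /= wg.
move=> e [eL de]; have [|u uI eu] := aI e.
  by split=> //; apply: tors_addIl eL.
have [|c uc] := gen (x *: u).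
  split; first exact: tors_colon.
  by rewrite linearZ /= -eu (tors_addIr eL).
exists c; have /bnd_colon_lift[b bI ub] : bnd (colon I x) (x *: (u - c *: w)).
  by rewrite scalerBr scalerA mulrC -scalerA wg.
have [b_tors db] := bnd_cocyc bI.
exists (u - c *: w - b); last first.
  by rewrite linearB /= db subr0 linearB -eu [d i (c *: w)]linearZ.
apply: tors_addI => //; apply: torsB => //. apply: torsB => //.
exact: (is_submodZ (@tors_submod _ _ I)).
Qed.

End Complex.

(** * Finiteness of the cohomology *)

Section Kills.
Variables (R : comPzRingType) (V : lmodType R).

(** The value at v of the linear map R^n -> V with coefficients z. *)
Definition act n (v : 'rV[R]_n) (z : {ffun 'I_n -> V}) : V := \sum_j v 0 j *: z j.

Lemma act_linear_l n a (v w : 'rV[R]_n) z :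
  act (a *: v + w) z = a *: act v z + act w z.
Proof.
rewrite /act scaler_sumr -big_split /=; apply: eq_bigr => j _.
by rewrite !mxE scalerDl scalerA.
Qed.

Lemma act_linear_r n (v : 'rV[R]_n) a z z' :
  act v (a *: z + z') = a *: act v z + act v z'.
Proof.
rewrite /act scaler_sumr -big_split /=; apply: eq_bigr => j _.
by rewrite !ffunE scalerDr !scalerA mulrC.
Qed.

Lemma act0l n (z : {ffun 'I_n -> V}) : act 0 z = 0.
Proof. by rewrite /act big1 // => j _; rewrite mxE scale0r. Qed.

Lemma act0r n (v : 'rV[R]_n) : act v (0 : {ffun 'I_n -> V}) = 0.
Proof. by rewrite /act big1 // => j _; rewrite ffunE scaler0. Qed.

Lemma act_sum n p (c : 'rV[R]_p) (ls : 'I_p -> 'rV[R]_n) z :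
  act (\sum_k c 0 k *: ls k) z = \sum_k c 0 k *: act (ls k) z.
Proof.
rewrite /act; under [RHS]eq_bigr do rewrite scaler_sumr.
rewrite exchange_big /=; apply: eq_bigr => j _.
rewrite summxE scaler_suml; apply: eq_bigr => k _.
by rewrite mxE scalerA.
Qed.

Definition kills n (L : 'rV[R]_n -> Prop) (z : {ffun 'I_n -> V}) :=
  forall v, L v -> act v z = 0.

End Kills.

Lemma act_map (R : comPzRingType) (V W : lmodType R) (f : {linear V -> W})
    n (v : 'rV[R]_n) (z : {ffun 'I_n -> V}) :
  act v [ffun j => f (z j)] = f (act v z).
Proof. by rewrite /act linear_sum; apply: eq_bigr => j _; rewrite ffunE linearZ. Qed.

Lemma row_span (R : comPzRingType) n (v : 'rV[R]_n) :
  span (codom (fun j => delta_mx 0 j : 'rV[R]_n)) v.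
Proof.
rewrite [v]row_sum_delta; apply: (is_submod_sum (span_submod _)) => j.
exact/(is_submodZ (span_submod _))/span_mem/codom_f.
Qed.

Lemma span_sum (R : comPzRingType) (V : lmodType R) (l : seq V) x :
  span l x -> exists c : 'rV[R]_(size l), x = \sum_k c 0 k *: l`_k.
Proof.
elim: l x => [|v l IH] x /=; first by move=> ->; exists 0; rewrite big_ord0.
move=> [a /IH[c xc]]; exists (\row_k (if unlift ord0 k is Some j then c 0 j else a)).
rewrite big_ord_recl mxE unlift_none -[LHS](subrK (a *: v)) xc addrC.
by congr (_ + _); apply: eq_bigr => k _; rewrite mxE liftK.
Qed.

(** Pairing each combination of the ls with the same combination of the w gives
    the graph of a partial linear map, which injectivity extends. *)
Lemma extend_rows (R : comPzRingType) (E : lmodType R) n p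
    (ls : 'I_p -> 'rV[R]_n) (w : {ffun 'I_p -> E}) :
  injective_module E ->
  kills (fun c => \sum_k c 0 k *: ls k = 0) w ->
  exists z : {ffun 'I_n -> E}, forall k, act (ls k) z = w k.
Proof.
move=> injE ww.
pose G (v : 'rV[R]_n) (x : E) :=
  exists2 c : 'rV[R]_p, v = \sum_k c 0 k *: ls k & x = act c w.
have [|a v v' x x' [c -> ->] [c' -> ->]|x [c c0 ->]|h hG] :=
  extend_relation injE (G := G).
- exists 0; last by rewrite act0l.
  by rewrite big1 // => k _; rewrite mxE scale0r.
- exists (a *: c + c'); last by rewrite act_linear_l.
  rewrite scaler_sumr -big_split /=; apply: eq_bigr => k _.
  by rewrite !mxE scalerDl scalerA.
- exact: ww.
exists [ffun j => h (delta_mx 0 j)] => k.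
have -> : act (ls k) [ffun j => h (delta_mx 0 j)] = h (ls k).
  rewrite {2}[ls k]row_sum_delta linear_sum; apply: eq_bigr => j _.
  by rewrite ffunE linearZ.
apply: hG; exists (delta_mx 0 k).
  rewrite (bigD1 k) //= mxE !eqxx scale1r big1 ?addr0 // => j jk.
  by rewrite mxE (negbTE jk) andbF scale0r.
rewrite /act (bigD1 k) //= mxE !eqxx scale1r big1 ?addr0 // => j jk.
by rewrite mxE (negbTE jk) andbF scale0r.
Qed.

Section Finiteness.
Variables (R : comPzRingType) (M : lmodType R) (E : nat -> lmodType R).
Variables (e : {linear M -> E 0%N}) (d : forall n, {linear E n -> E n.+1}).
Hypothesis noethR : noetherian R.
Hypothesis resE : injective_resolution e d.
Variable gens : seq M.
Hypothesis gensP : forall x : M, span gens x.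

Lemma resolution_inj n : injective_module (E n).
Proof. by case: resE. Qed.

Lemma resolution_dd n x : d n.+1 (d n x) = 0.
Proof. by have [_ _ _ ex] := resE; apply/ex; exists x. Qed.

Definition row_bnd n (L : 'rV[R]_n -> Prop) i : {ffun 'I_n -> E i} -> Prop :=
  match i return {ffun 'I_n -> E i} -> Prop with
  | 0 => fun z => z = 0
  | k.+1 => fun z => exists2 u, kills L u & z = [ffun j => d k (u j)]
  end.

Definition row_cocyc n (L : 'rV[R]_n -> Prop) i (z : {ffun 'I_n -> E i}) :=
  kills L z /\ forall j, d i (z j) = 0.

Definition dff n i (z : {ffun 'I_n -> E i}) : {ffun 'I_n -> E i.+1} :=
  [ffun j => d i (z j)].

Fact dff_linear n i a (z z' : {ffun 'I_n -> E i}) :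
  dff (a *: z + z') = a *: dff z + dff z'.
Proof. by apply/ffunP => j; rewrite !ffunE linearD linearZ. Qed.

Fact eff_linear n a (z z' : {ffun 'I_n -> M}) :
  [ffun j => e ((a *: z + z') j)] = a *: [ffun j => e (z j)] + [ffun j => e (z' j)].
Proof. by apply/ffunP => j; rewrite !ffunE linearD linearZ. Qed.

Fact single_linear n (j : 'I_n) a (x y : M) :
  [ffun k => if k == j then a *: x + y else 0] =
  a *: [ffun k => if k == j then x else 0] + [ffun k => if k == j then y else 0]
    :> {ffun 'I_n -> M}.
Proof.
by apply/ffunP => k; rewrite !ffunE; case: (k == j); rewrite ?scaler0 ?addr0.
Qed.

Lemma ffun_span n : exists l : seq {ffun 'I_n -> M}, forall z, span l z.
Proof.
pose sg j := mk_linear (@single_linear n j).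
exists (flatten [seq map (sg j) gens | j <- enum 'I_n]) => z.
have -> : z = \sum_j sg j (z j).
  apply/ffunP => k; rewrite sum_ffunE (bigD1 k) //= ffunE eqxx big1 ?addr0 // => j jk.
  by rewrite ffunE eq_sym (negbTE jk).
apply: (is_submod_sum (span_submod _)) => j.
apply: (@span_mono _ _ (map (sg j) gens)) => [v vj|].
  by apply/flatten_mapP; exists j; rewrite ?mem_enum.
exact/span_image/gensP.
Qed.

(** Dimension shifting for Ext^i(R^n / L, M): if L is generated by p rows with
    module of syzygies L', then evaluating a preimage under d at these rows
    turns a cocycle of degree i + 1 for L into one of degree i for L'. *)
Lemma row_cohomology_fg i n (L : 'rV[R]_n -> Prop) : is_submod L ->
  exists l : seq {ffun 'I_n -> E i},
    (forall g, g \in l -> row_cocyc L g) /\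
    forall z, row_cocyc L z -> exists2 y, span l y & row_bnd L (z - y).
Proof.
elim: i n L => [|i IH] n L subL.
  have [l gen] := ffun_span n.
  pose P (r : {ffun 'I_n -> M}) := kills L [ffun j => e (r j)].
  have subP : is_submod P.
    split=> [v _|a r r' Pr Pr' v Lv].
      rewrite (_ : finfun _ = 0) ?act0r //.
      by apply/ffunP => j; rewrite !ffunE linear0.
    by rewrite eff_linear act_linear_r Pr // Pr' // scaler0 addr0.
  have [rs [rsP Prs]] := fg_sub_span noethR subP (fun r _ => gen r).
  pose ef := mk_linear (@eff_linear n).
  have [_ _ ex _] := resE.
  exists (map ef rs); split=> [g /mapP[r /rsP Pr ->]|z [zL dz]].
    split=> [v /Pr //|j]; rewrite ffunE; apply/ex; by exists (r j).
  have /choice[r zr] j : exists x, z j = e x by apply/ex.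
  exists z; last by rewrite subrr.
  have -> : z = ef [ffun j => r j] by apply/ffunP => j; rewrite !ffunE zr.
  apply/span_image/Prs; rewrite /P (_ : finfun _ = z) //.
  by apply/ffunP => j; rewrite !ffunE zr.
have [ls [lsL Lls]] := fg_sub_span noethR subL (fun x _ => row_span x).
pose row_k (k : 'I_(size ls)) := ls`_k.
have rowL k : L (row_k k) by apply/lsL/mem_nth.
have killsP j (z : {ffun 'I_n -> E j}) :
    (forall k, act (row_k k) z = 0) -> kills L z.
  move=> z0 v /Lls/span_sum[c ->]; rewrite (act_sum c row_k) big1 // => k _.
  by rewrite z0 scaler0.
pose L' (c : 'rV[R]_(size ls)) := \sum_k c 0 k *: row_k k = 0.
have subL' : is_submod L'.
  split=> [|a c c' Lc Lc']; first by apply: big1 => k _; rewrite mxE scale0r.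
  rewrite /L'; under eq_bigr do rewrite !mxE scalerDl -scalerA.
  by rewrite big_split -scaler_sumr /= Lc Lc' scaler0 addr0.
have lift j (w : {ffun 'I_(size ls) -> E j}) : kills L' w ->
    exists z : {ffun 'I_n -> E j}, forall k, act (row_k k) z = w k.
  by apply: extend_rows; apply: resolution_inj.
have bnd_lift (b : {ffun 'I_(size ls) -> E i}) : row_bnd L' b ->
    exists2 u, forall k, act (row_k k) u = b k & dff u = 0.
  case: i {IH} b => [|i] b /=.
    move=> ->; exists 0 => [k|]; first by rewrite act0r ffunE.
    by apply/ffunP => j; rewrite !ffunE linear0.
  move=> [u uL' ->]; have [v vu] := lift _ _ uL'.
  exists (dff v) => [k|]; first by rewrite act_map vu ffunE.
  by apply/ffunP => j; rewrite !ffunE resolution_dd.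
have [gs [gsL' gen]] := IH _ _ subL'.
(* The preimages es of the generators gs under evaluation at the rows: their
   differentials will generate in degree i + 1. *)
have [es [esL es_gs]] : exists es : seq {ffun 'I_n -> E i},
    (forall u, u \in es -> row_cocyc L (dff u)) /\
    forall w, span gs w ->
      exists2 u, span es u & forall k, act (row_k k) u = w k.
  elim: gs gsL' {gen} => [|g gs IHg] gsL'.
    exists [::]; split=> // w ->; exists 0 => // k.
    by rewrite act0r ffunE.
  have [es [esL es_gs]] := IHg (in_tail gsL').
  have [gL dg] := gsL' g (mem_head _ _).
  have [u ug] := lift _ _ gL.
  exists (u :: es); split=> [u'|w [c /es_gs[u' u'es u'w]]].
    rewrite inE => /orP[/eqP->|/esL //].
    split=> [|j]; last by rewrite ffunE resolution_dd.
    by apply: killsP => k; rewrite act_map ug dg.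
  exists (c *: u + u'); first by exists c; rewrite addrC addKr.
  by move=> k; rewrite act_linear_r ug u'w !ffunE addrC subrK.
exists (map (@dff n i) es); split=> [g /mapP[u /esL ? ->] //|z [zL dz]].
have [_ _ _ ex] := resE.
have /choice[e1 ze1] j : exists x, z j = d i x by apply/ex.
pose u1 := [ffun j => e1 j].
have zu1 : z = dff u1 by apply/ffunP => j; rewrite !ffunE.
have [|w wgs zw] := gen [ffun k => act (row_k k) u1].
  split=> [c Lc|k]; last by rewrite ffunE -act_map -[finfun _]zu1 zL.
  have -> : act c [ffun k => act (row_k k) u1] = act (\sum_k c 0 k *: row_k k) u1.
    by rewrite act_sum; apply: eq_bigr => k _; rewrite ffunE.
  by rewrite Lc act0l.
have [uw uwes uww] := es_gs w wgs.
have [u2 u2b du2] := bnd_lift _ zw.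
exists (dff uw); first exact: (span_image (mk_linear (@dff_linear n i))).
exists (u1 - uw - u2).
  apply: killsP => k.
  have actB (u v : {ffun 'I_n -> E i}) : act (row_k k) (u - v) =
      act (row_k k) u - act (row_k k) v.
    by rewrite [u - v]addrC -[- v]scaleN1r act_linear_r scaleN1r addrC.
  by rewrite !actB uww u2b !ffunE subrr.
rewrite -[RHS]/(dff (u1 - uw - u2)) -[RHS]/(mk_linear (@dff_linear n i) _).
by rewrite !linearB /= -zu1 du2 subr0.
Qed.

Lemma cohomology_fg (I : ideal R) i :
  exists l : seq (E i), (forall g, g \in l -> cocyc d I g) /\
    forall z, cocyc d I z -> exists2 y, span l y & bnd d I (z - y).
Proof.
pose L (v : 'rV[R]_1) := v 0 0 \in submod_pred I.
have subL : is_submod L.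
  split=> [|a v w vI wI]; first by rewrite /L mxE; apply: ideal0.
  by rewrite /L !mxE; apply: idealD => //; apply: idealM.
have killsE j (z : {ffun 'I_1 -> E j}) : kills L z <-> tors I (z 0).
  split=> [zL a aI|zI v vL].
    have := zL (const_mx a); rewrite /L /act big_ord1 !mxE; exact.
  by rewrite /act big_ord1; apply: zI.
have [l [lL gen]] := row_cohomology_fg i subL.
pose ev := fun z : {ffun 'I_1 -> E i} => z 0.
have ev_linear a z z' : ev (a *: z + z') = a *: ev z + ev z' by rewrite /ev !ffunE.
exists (map (mk_linear ev_linear) l); split=> [g /mapP[z /lL[/killsE zI dz] ->]|z [zI dz]].
  by split; [apply: zI | apply: dz].
have [|y yl zy] := gen [ffun=> z].
  by split=> [|j]; [apply/killsE; rewrite ffunE | rewrite ffunE].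
exists (ev y); first exact: (span_image (mk_linear ev_linear)).
have -> : z - ev y = ([ffun=> z] - y) 0 by rewrite !ffunE.
move: (_ - y) zy => b {y yl z zI dz lL gen l ev_linear ev}.
case: i b => [|i] b /=; first by move=> ->; rewrite ffunE.
by move=> [u /killsE uI ->]; exists (u 0); rewrite ?ffunE.
Qed.

End Finiteness.

(** * Koszul towers *)

Section Towers.
Variables (R : comPzRingType) (E : nat -> lmodType R).
Variable d : forall n, {linear E n -> E n.+1}.
Hypothesis injE : forall n, injective_module (E n).
Hypothesis dd : forall n x, d n.+1 (d n x) = 0.
Variables (T : nat -> ideal R) (x : nat -> R) (l : nat).

(** T j is generated over T 0 by the first j terms of x, a regular sequence on
    R / T 0. *)
Definition tower := forall j, (j < l)%N ->
  submod_pred (T j.+1) =i submod_pred (addI (T j) (x j)) /\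
  forall a, a * x j \in submod_pred (T j) -> a \in submod_pred (T j).

Hypothesis towerT : tower.

Lemma tower_add j : (j < l)%N ->
  submod_pred (addI (T j) (x j)) =i submod_pred (T j.+1).
Proof. by move=> /towerT[eT _] a; rewrite eT. Qed.

Lemma tower_colon j : (j < l)%N ->
  submod_pred (T j) =i submod_pred (colon (T j) (x j)).
Proof.
move=> /towerT[_ reg] a; apply/idP/idP => [|/mem_colon/reg //].
exact: sub_colon.
Qed.

Lemma tower_sub j : (j < l)%N -> {subset submod_pred (T j) <= submod_pred (T j.+1)}.
Proof. by move=> jl a aT; rewrite -(tower_add jl); apply: sub_addI. Qed.

Lemma tower_acycS j i : (j < l)%N ->
  acyc d (T j) i.+1 -> acyc d (T j) i -> acyc d (T j.+1) i.+1.
Proof.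
move=> jl a1 a0; apply: acyc_eq (tower_add jl) _; apply: acyc_addI => //.
exact: acyc_eq (tower_colon jl) a0.
Qed.

Lemma tower_acyc_all j : (j <= l)%N ->
  (forall i, acyc d (T 0) i) -> forall i, acyc d (T j) i.
Proof.
move=> jl a0; elim: j jl => // j IH jl [|i].
  by apply: acyc0_sub (tower_sub jl) _; apply: IH; apply: ltnW.
by apply: tower_acycS => //; apply: IH; apply: ltnW.
Qed.

Lemma tower_acyc_above j : (j <= l)%N ->
  (forall i, acyc d (T 0) i.+1) -> forall i, (j < i)%N -> acyc d (T j) i.
Proof.
move=> jl a0; elim: j jl => [_ [|i] //|j IH jl [//|i]].
rewrite ltnS => ji; apply: tower_acycS => //; apply: IH => //; try exact: ltnW.

Qed.

Lemma tower_cyc j : (j <= l)%N ->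
  (forall i, acyc d (T 0) i.+1) -> cyc d (T 0) 0 -> cyc d (T j) j.
Proof.
move=> jl a0 c0; elim: j jl => // j IH jl.
apply: cyc_eq (tower_add jl) _; apply: cyc_addI => //.
  exact: tower_acyc_above (ltnW jl) a0 _ _.
by apply: cyc_eq (tower_colon jl) _; apply: IH; apply: ltnW.
Qed.

(** The submodule (x 0, ..., x (j-1)) H of the module H of 0-cocycles of T 0. *)
Fixpoint mults (j : nat) (z : E 0%N) : Prop :=
  if j is j'.+1 then exists2 z', cocyc d (T 0) z' & mults j' (z - x j' *: z')
  else z = 0.

(** The graph, modulo coboundaries, of the composite of the connecting maps
    H^i(T i) -> H^(i+1)(T (i+1)) for i < j: such a map divides a cocycle by x i
    and applies d. *)
Fixpoint link (j : nat) : E 0%N -> E j -> Prop :=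
  match j return E 0%N -> E j -> Prop with
  | 0 => fun z e => cocyc d (T 0) z /\ e = z
  | j'.+1 => fun z e => exists u,
      [/\ tors (T j') u, link z (x j' *: u) & bnd d (T j'.+1) (e - d j' u)]
  end.

(** The linked pairs form an isomorphism from the 0-cocycles of T 0 modulo
    (x 0, ..., x (j-1)) onto the cohomology of T j in degree j. *)
Record connected (j : nat) : Prop := Connected {
  link_cocyc0 : forall z (e : E j), link z e -> cocyc d (T 0) z;
  link_cocyc : forall z (e : E j), link z e -> cocyc d (T j) e;
  link_linear : forall a z (e : E j) z' e', link z e -> link z' e' ->
    link (a *: z + z') (a *: e + e');
  link_total : forall z, cocyc d (T 0) z -> exists e : E j, link z e;
  link_onto : forall e : E j, cocyc d (T j) e -> exists z, link z e;
  link_bnd : forall e : E j, link 0 e <-> bnd d (T j) e;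
  link_mults : forall z, cocyc d (T 0) z -> link z (0 : E j) <-> mults j z
}.

Lemma linkB j z (e : E j) z' e' : connected j ->
  link z e -> link z' e' -> link (z - z') (e - e').
Proof.
move=> cj ze ze'; have := link_linear cj (-1) ze' ze.
by rewrite !scaleN1r ![- _ + _]addrC.
Qed.

Lemma linkZ j a z (e : E j) : connected j -> link z e -> link (a *: z) (a *: e).
Proof.
move=> cj ze; rewrite -[a *: z]addr0 -[a *: e]addr0; apply: link_linear => //.
by apply/link_bnd => //; case: (bnd_submod d (T j) j).
Qed.

Lemma link_step j : (j < l)%N -> acyc d (T j) j.+1 ->
  connected j -> connected j.+1.
Proof.
move=> jl aT cj; have [S0 Sj SL Stot Sonto Sbnd Smul] := cj.
have d_cocyc z u : tors (T j) u -> link z (x j *: u) -> cocyc d (T j.+1) (d j u).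
  move=> uT /Sj[_ dxu]; split; last exact: dd.
  apply: (tors_sub (L := addI (T j) (x j))) => [a|].
    by rewrite (tower_add jl).
  apply: tors_addI => [a aT'|]; first by rewrite -linearZ uT // linear0.
  by rewrite -linearZ.
have tors_next (u : E j) : tors (T j) u -> x j *: u = 0 -> tors (T j.+1) u.
  by move=> uT xu a; rewrite -(tower_add jl); apply: tors_addI.
have x_next i (u : E i) : tors (T j.+1) u -> x j *: u = 0.
  by move=> uT; apply: uT; rewrite -(tower_add jl); apply: addI_mem.
have divide z (e : E j) : link z e -> exists2 u, tors (T j) u & x j *: u = e.
  move=> /Sj[eT _]; apply: tors_divide => // a; rewrite -(tower_colon jl).
  exact: eT.
have bnd0 i : @bnd _ _ d (T j.+1) i 0 by case: (bnd_submod d (T j.+1) i).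
split.
- by move=> z e [u [_ /S0]].
- move=> z e [u [uT /(d_cocyc _ _ uT) du eu]]; rewrite -(subrK (d j u) e).
  by apply: (is_submodD (cocyc_submod d (T j.+1) j.+1)) => //; apply: bnd_cocyc.
- move=> a z e z' e' [u [uT zu eu]] [u' [u'T z'u' e'u']].
  exists (a *: u + u'); split; first exact: (@tors_submod _ _ (T j)).2.
    by rewrite scalerDr scalerA mulrC -scalerA; apply: SL.
  rewrite linearD linearZ /= opprD addrACA -scalerBr.
  exact: (bnd_submod d (T j.+1) j.+1).2.
- move=> z /Stot[e ze]; have [u uT ue] := divide _ _ ze.
  by exists (d j u), u; rewrite ue subrr; split.
- move=> e [eT de]; have [|u uT eu] := aT e.
    by split=> //; apply: tors_sub (tower_sub jl) eT.
  have [|z zu] := Sonto (x j *: u).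
    split=> [a aT'|]; first by rewrite scalerA mulrC -scalerA uT // scaler0.
    by rewrite linearZ /= -eu (x_next _ _ eT).
  by exists z, u; rewrite eu subrr; split.
- move=> e; split=> [[u [uT /Sbnd xu eu]]|eb].
    have [|b bT ub] := @bnd_colon_lift _ _ d injE (T j) (x j) j u.
      by apply: bnd_sub xu => a; rewrite -(tower_colon jl).
    have [b_tors db] := bnd_cocyc dd bT.
    rewrite -(subrK (d j u) e); apply: (is_submodD (bnd_submod d (T j.+1) j.+1)) => //.
    exists (u - b); last by rewrite linearB /= db subr0.
    by apply: tors_next => //; apply: torsB.
  exists 0; split; first exact: (@tors_submod _ _ (T j)).1.
    by rewrite scaler0; apply/Sbnd; case: (bnd_submod d (T j) j).
  by rewrite (linear0 (d j)) subr0.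
- move=> z z0; split=> [[u [uT zu]]|[z' z'0 /Smul zz']].
    rewrite sub0r => /(is_submodN (bnd_submod d (T j.+1) j.+1)); rewrite opprK.
    move=> [b bT ub]; have [|z' z'u] := Sonto (u - b).
      split; last by rewrite linearB /= ub subrr.
      by apply: torsB => //; apply: tors_sub (tower_sub jl) bT.
    exists z'; first exact: S0 z'u.
    have /Smul : link (z - x j *: z') (0 : E j).
      rewrite -(subrr (x j *: u)); apply: linkB => //.
      by have := linkZ (x j) cj z'u; rewrite scalerBr (x_next _ _ bT) subr0.
    apply; apply: (is_submodB (cocyc_submod d (T 0) 0)) => //.
    exact/(is_submodZ (cocyc_submod d (T 0) 0))/(S0 _ _ z'u).
  have [e z'e] := Stot z' z'0; have [eT de] := Sj _ _ z'e.
  exists e; rewrite de subrr; split=> //.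
  have := SL 1 _ _ _ _ (zz' _) (linkZ (x j) cj z'e).
  rewrite !scale1r subrK add0r; apply.
  apply: (is_submodB (cocyc_submod d (T 0) 0)) => //.
  exact: (is_submodZ (cocyc_submod d (T 0) 0)).
Qed.

Lemma tower_connected j : (j <= l)%N ->
  (forall i, (i < j)%N -> acyc d (T i) i.+1) -> connected j.
Proof.
elim: j => [_ _|j IH jl aT].
  split=> [z e [] //|z e [z0 ->] //|a z e z' e' [z0 ->] [z'0 ->]|z z0|z z0|e|z z0].
  - by split=> //; apply: (cocyc_submod d (T 0) 0).2.
  - by exists z.
  - by exists z.
  - by split=> [[_ ->]|->] //; split=> //; apply: (cocyc_submod d (T 0) 0).1.
  - by split=> [[_ <-]|->] //; split=> //; apply: (cocyc_submod d (T 0) 0).1.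
apply: link_step => //; first exact: aT.
by apply: IH (ltnW jl) _ => i ij; apply: aT; apply: ltnW.
Qed.

Lemma connected_regular j : (j < l)%N -> connected j ->
  acyc d (T j.+1) j -> forall z, cocyc d (T 0) z ->
  mults j (x j *: z) -> mults j z.
Proof.
move=> jl cj aT z z0; have [S0 Sj SL Stot Sonto Sbnd Smul] := cj.
have xz0 : cocyc d (T 0) (x j *: z) by apply: (is_submodZ (cocyc_submod d (T 0) 0)).
move=> /(Smul _ xz0) xz; have [e ze] := Stot z z0.
have /Sbnd xe : link 0 (x j *: e).
  by rewrite -(subrr (x j *: z)) -[x j *: e]subr0; apply: linkB => //; apply: linkZ.
have [eT de] := Sj _ _ ze.
have [|b bT eb] := @bnd_colon_lift _ _ d injE (T j) (x j) j e.
  by apply: bnd_sub xe => a; rewrite -(tower_colon jl).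
have [b_tors db] := bnd_cocyc dd bT.
have ebT : bnd d (T j) (e - b).
  apply: bnd_sub (tower_sub jl) _; apply: aT; split.
    by move=> a; rewrite -(tower_add jl); apply: tors_addI => //; apply: torsB.
  by rewrite linearB /= de db subrr.
have /Sbnd e0 : bnd d (T j) e.
  by rewrite -(subrK b e); apply: (is_submodD (bnd_submod d (T j) j)).
by apply/Smul => //; rewrite -(subr0 z) -(subrr e); apply: linkB.
Qed.

Lemma regular_connected j : (j < l)%N -> connected j ->
  (forall i, j = i.+1 -> acyc d (T j) i) ->
  (forall z, cocyc d (T 0) z -> mults j (x j *: z) -> mults j z) ->
  acyc d (T j.+1) j.
Proof.
move=> jl cj aT reg e [eT de]; have [S0 Sj SL Stot Sonto Sbnd Smul] := cj.
have eT' : tors (T j) e by apply: tors_sub (tower_sub jl) eT.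
have [|z ze] := Sonto e; first by split.
have z0 := S0 _ _ ze.
have xz0 : cocyc d (T 0) (x j *: z) by apply: (is_submodZ (cocyc_submod d (T 0) 0)).
have /(Smul _ xz0)/(reg z z0)/(Smul _ z0) z0' : link (x j *: z) (0 : E j).
  suff <- : x j *: e = 0 by apply: linkZ.
  by apply: eT; rewrite -(tower_add jl); apply: addI_mem.
have /Sbnd : link 0 e by rewrite -(subrr z) -[e]subr0; apply: linkB.
case: j jl aT e eT de eT' {cj S0 Sj SL Stot Sonto Sbnd Smul reg z ze z0 xz0 z0'}
  => [|j] jl aT e eT de eT' eb //.
apply: bnd_sub (_ : {subset submod_pred (T j.+2) <= submod_pred (addI (T j.+1) (x j.+1))}) _.
  by move=> a; rewrite (tower_add jl).
apply: bnd_addI => //.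
  exact: acyc_eq (tower_colon jl) (aT _ _).
by split=> // a; rewrite (tower_add jl); apply: eT.
Qed.

(** The cohomology of T (j+1) in degree j is the kernel of x j on that of T j,
    which the linked pairs identify with H / (x 0, ..., x (j-1)) H. *)
Lemma tower_acyc_below j : (j <= l)%N ->
  (forall i, acyc d (T 0) i.+1) ->
  (forall i z, (i < l)%N -> cocyc d (T 0) z -> mults i (x i *: z) -> mults i z) ->
  forall i, (i < j)%N -> acyc d (T j) i.
Proof.
move=> jl a0 reg; elim: j jl => // j IH jl i.
have jl' := ltnW jl.
rewrite ltnS leq_eqVlt => /orP[/eqP->|ij].
  apply: regular_connected => //.
  - apply: tower_connected => // k kj; apply: tower_acyc_above => //.
    exact: leq_trans (ltnW kj) jl'.
  - by move=> k jk; apply: IH => //; rewrite jk.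
  - by move=> z; apply: reg.
case: i ij => [|i] ij; first by apply: acyc0_sub (tower_sub jl) _; apply: IH.
by apply: tower_acycS => //; apply: IH => //; apply: ltnW.
Qed.

End Towers.

(** * Vanishing of cohomology over a local ring *)

Section Vanishing.
Variables (R : comPzRingType) (m : ideal R) (M : lmodType R).
Variables (E : nat -> lmodType R) (e : {linear M -> E 0%N}).
Variable d : forall n, {linear E n -> E n.+1}.
Hypotheses (noethR : noetherian R) (localm : local_at m) (finM : fin_gen M).
Hypothesis resE : injective_resolution e d.

Implicit Types (I P : ideal R).

Let injE : forall n, injective_module (E n) := resolution_inj resE.
Let dd : forall n x, d n.+1 (d n x) = 0 := resolution_dd resE.

Lemma acyc_nakayama I (x : R) i : x \in submod_pred m ->
  (forall a, a * x \in submod_pred I -> a \in submod_pred I) ->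
  acyc d (addI I x) i.+1 -> acyc d I i.
Proof.
move=> xm regx aL; have [gens gensP] := fin_gen_span finM.
have [l [lI gen]] := cohomology_fg noethR resE gensP I i.
apply: (nakayama noethR localm (cocyc_submod d I i) (bnd_submod d I i) xm lI gen).
move=> z [zI dz]; have [|z' z'I ->] := cocyc_divide injE dd aL (w := z).
  by split=> // a /mem_colon/regx; apply: zI.
by exists z' => //; rewrite subrr; case: (bnd_submod d I i).
Qed.

Lemma acyc_unit I i : 1 \in submod_pred I -> acyc d I i.
Proof.
move=> I1 z [zI _]; have -> : z = 0 by rewrite -[z]scale1r zI.
by case: (bnd_submod d I i).
Qed.

(** Devissage along R / I, which is filtered by quotients R / P. *)
Lemma acyc_devissage I i :
  (forall P, prime_ideal P -> {subset submod_pred I <= submod_pred P} ->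
     acyc d P i) ->
  acyc d I i.
Proof.
elim/(noetherian_ind noethR): I => I IH aP.
have [I1|/negP I1] := EM (1 \in submod_pred I); first exact: acyc_unit.
have [[x [y [xI yI xyI]]]|nodiv] := EM (exists x y,
    [/\ x \notin submod_pred I, y \notin submod_pred I & y * x \in submod_pred I]).
  have addS := @sub_addI _ I x; have colonS := @sub_colon _ I x.
  apply: (acyc_middle injE dd (x := x)).
    apply: IH => //; first by exists x => //; apply: addI_mem.
    by move=> P Pp IP; apply: aP => // a /addS/IP.
  apply: IH => //; first by exists y => //; apply/mem_colon.
  by move=> P Pp IP; apply: aP => // a /colonS/IP.
apply: aP => //; split=> // a b abI; apply: contrapT => /not_orP[/negP aI /negP bI].
by apply: nodiv; exists b, a.
Qed.

(** Descending induction from the end of the resolution.  At a prime other than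
    m, an element of m outside the prime is a nonzerodivisor, so vanishing in
    the next degree makes it act surjectively, and Nakayama's lemma applies. *)
Lemma acyc_vanishing r N :
  (forall i, (N <= i)%N -> forall z : E i, z = 0) ->
  (forall i, (r <= i)%N -> acyc d m i) ->
  forall I i, (r <= i)%N -> acyc d I i.
Proof.
move=> Etop am I i ri.
have [k kN] : exists k, (N <= i + k)%N by exists N; apply: leq_addl.
elim: k i ri kN I => [|k IH] i ri kN I.
  move: kN; rewrite addn0 => Ni z _; rewrite (Etop i Ni z).
  by case: (bnd_submod d I i).
apply: acyc_devissage => P Pp _; have [P1 PM] := Pp.
have Pm := local_sub noethR localm P1.
have [mP|nmP] := EM {subset submod_pred m <= submod_pred P}.
  by apply: acyc_eq (am i ri) => a; apply/idP/idP => [/mP|/Pm].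
have [x xm xP] : exists2 x, x \in submod_pred m & x \notin submod_pred P.
  apply: contrapT => nox; apply: nmP => x xm.
  by apply: contrapT => /negP xP; apply: nox; exists x.
apply: (acyc_nakayama xm) => [a /PM[//|xP']|]; first by rewrite xP' in xP.
by apply: IH; [apply: leqW | rewrite addSnnS].
Qed.

(** A generator x added to L keeps the vanishing in degree i + 1, because the
    long exact sequence only brings in degree i of the larger ideal (L : x). *)
Lemma acyc_above_ideal I0 t : (forall i, (i < t)%N -> acyc d I0 i) ->
  forall i, (i < t)%N -> forall I, {subset submod_pred I0 <= submod_pred I} ->
  acyc d I i.
Proof.
move=> a0; elim=> [|i IH] it I I0I.
  exact: acyc0_sub I0I (a0 _ it).
have [l [lI Il]] := fg_ideal noethR (submodule_is_submod I).
suff [L [LI lL I0L aL]] : exists L, [/\ {subset submod_pred L <= submod_pred I},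
    forall v : R^o, v \in l -> v \in submod_pred L,
    {subset submod_pred I0 <= submod_pred L} & acyc d L i.+1].
  apply: acyc_eq aL => a; apply/idP/idP => [/LI //|/Il].
  exact: span_sub (submodule_is_submod L) lL.
elim: l lI {Il} => [|x l IHl] lI; first by exists I0; split=> //; apply: a0.
have [L [LI lL I0L aL]] := IHl (in_tail lI).
exists (addI L x); split.
- move=> a /mem_addI[c acx]; rewrite -[a](subrK (c * x)); apply: idealD.
    exact: LI.
  by apply/idealM/lI; rewrite mem_head.
- move=> v; rewrite inE => /orP[/eqP->|/lL]; [exact: addI_mem | exact: sub_addI].
- by move=> a /I0L; apply: sub_addI.
apply: acyc_addI => //; apply: IH; first exact: ltnW.
by move=> a /I0L; apply: sub_colon.
Qed.

(** Each step down the tower is an application of acyc_nakayama, and lowers the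
    degree by one. *)
Lemma tower_acyc_down (T : nat -> ideal R) (x : nat -> R) l i k j :
  tower T x l -> (forall n, (n < l)%N -> x n \in submod_pred m) ->
  (j + k = l)%N -> acyc d (T l) (i + k) -> acyc d (T j) i.
Proof.
move=> towerT xm; elim: k i j => [|k IH] i j.
  by rewrite !addn0 => ->.
rewrite addnS -addSn => jkl.
have jl : (j < l)%N by rewrite -jkl addSn ltnS leq_addr.
rewrite -addSnnS => aT; apply: (acyc_nakayama (xm j jl) (towerT j jl).2).
exact: acyc_eq (fun a => esym (tower_add towerT jl a)) (IH _ _ jkl aT).
Qed.

End Vanishing.

(** * Regular sequences on the module of 0-cocycles *)

Lemma mults_in_seq_mul (A R : comPzRingType) (h : {rmorphism A -> R})
    (E : nat -> lmodType R) (d : forall n, {linear E n -> E n.+1})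
    (T : nat -> ideal R) (K : lmodType A) (k : K -> E 0%N) (s : seq A) j z :
  (forall a z z', k (a *: z + z') = h a *: k z + k z') -> injective k ->
  (forall w, cocyc d (T 0%N) w <-> exists z, w = k z) ->
  (j <= size s)%N ->
  mults d T (fun i => h s`_i) j (k z) <-> in_seq_mul (take j s) z.
Proof.
move=> kL kI kT; have kZB a u v : k (u - a *: v) = k u - h a *: k v.
  by rewrite addrC -scaleNr kL rmorphN scaleNr addrC.
have k0 : k 0 = 0 by have := kZB 1 0 0; rewrite scaler0 subr0 rmorph1 scale1r subrr.
elim: j z => [|j IH] z js /=.
  rewrite take0; split=> [z0|/in_seq_mul_nil -> //].
  by apply/in_seq_mul_nil/kI; rewrite z0 k0.
split=> [[z' /kT[u ->]]|/(in_seq_mul_take _ js)[u zu]].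
  by rewrite -kZB => /(IH _ (ltnW js)) zu; apply/in_seq_mul_take => //; exists u.
exists (k u); first by apply/kT; exists u.
by rewrite -kZB; apply/IH => //; apply: ltnW.
Qed.

Lemma quot_scale_mem (A : comPzRingType) (m : ideal A) (a : A) :
  a \in submod_pred m -> a *: quot_pi m 1 = 0.
Proof.
move=> am; have -> : a *: quot_pi m 1 = quot_pi m 0.
  rewrite -[LHS]/(quot_scale a _) quot_scale_pi; apply/quot_piP.
  by rewrite subr0 [_ *: _]mulr1.
apply: (@addrI _ (quot_pi m 0)); rewrite addr0 -quot_piD.
by rewrite addr0.
Qed.

Lemma quot_linear (A : comPzRingType) (m : ideal A) (V : lmodType A) (u : V) :
  tors m u ->
  exists phi : {linear quot_mod m -> V}, forall a, phi (quot_pi m a) = a *: u.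
Proof.
move=> um; pose f (q : quot_mod m) := (repr q : A) *: u.
have fE a : f (quot_pi m a) = (a : A) *: u.
  apply/eqP; rewrite -subr_eq0 -scalerBl; apply/eqP/um/quot_piP.
  exact: quot_piK.
have fL a x y : f (a *: x + y) = a *: f x + f y.
  rewrite -[x]quot_piK -[y]quot_piK.
  have -> : a *: quot_pi m (repr x) + quot_pi m (repr y) =
      quot_pi m (a * repr x + repr y).
    by rewrite quot_piD -quot_scale_pi.
  by rewrite !fE scalerDl scalerA.
by exists (mk_linear fL).
Qed.

Section MaxSize.
Variable T : Type.

Lemma exists_longest (P : seq T -> Prop) n :
  (exists s, P s) -> (forall s, P s -> (size s <= n)%N) ->
  exists2 s, P s & forall s', P s' -> (size s' <= size s)%N.
Proof.
move=> [s0 Ps0] Pn.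
pose Q k := `[< exists2 s, P s & size s = k >].
have exQ : exists k, Q k by exists (size s0); apply/asboolP; exists s0.
have Qn k : Q k -> (k <= n)%N by move=> /asboolP[s /Pn sn <-].
case: (ex_maxnP exQ Qn) => k /asboolP[s Ps sk] kmax.
by exists s => // s' Ps'; rewrite sk; apply: kmax; apply/asboolP; exists s'.
Qed.

End MaxSize.

(** * Canonical modules of retracts of Gorenstein rings *)

Section Retract.
Variables (A R : comPzRingType) (inj : {rmorphism A -> R}) (pr : {rmorphism R -> A}).
Variable m : ideal A.
Hypothesis prK : cancel inj pr.
Hypotheses (noethA : noetherian A) (localm : local_at m).
Hypotheses (noethR : noetherian R) (localR : exists m', @local_at R m').
Hypothesis finR : fin_gen (restr inj R^o).

Definition maxR : ideal R := contract pr m.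

Lemma mem_maxR r : (r \in submod_pred maxR) <-> pr r \in submod_pred m.
Proof. exact: mem_contract. Qed.

Lemma pr_kernel r : pr (r - inj (pr r)) = 0.
Proof. by rewrite rmorphB prK subrr. Qed.

Lemma local_maxR : local_at maxR.
Proof.
suff maxmR : maximal_ideal maxR.
  have [m' [_ m'uniq]] := localR; split=> // M /m'uniq Mm' a.
  by rewrite Mm' (m'uniq _ maxmR).
have mR1 : proper_id maxR.
  apply/negP => /mem_maxR; rewrite rmorph1; apply/negP.
  exact: local_proper localm.
split=> // I mRI I1 r; apply/idP/idP => [rI|/mRI //].
apply: contrapT => /negP rm.
have [|b br] := local_unit noethA localm (a := pr r).
  by apply/negP => /mem_maxR; apply/negP.
have : inj b * r - 1 \in submod_pred maxR.
  by apply/mem_maxR; rewrite rmorphB rmorphM prK br rmorph1 subrr; apply: ideal0.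
move=> /mRI brI; move/negP: I1; apply.
have -> : 1 = inj b * r - (inj b * r - 1) by ring.
by apply: idealB => //; apply: idealM.
Qed.

Section Dimension.
Variable n : nat.
Hypothesis dimA : has_dim A^o n.

Lemma retract_chain_le k p : prime_chain R^o k p -> (k <= n)%N.
Proof. by move=> /(contract_chain noethA finR); apply: dimA.2. Qed.

Variable xs : seq A.
Hypotheses (xs_m : {subset xs <= submod_pred m}) (xs_reg : regular_seq A^o xs).
Hypothesis xs_size : size xs = n.

(** Below a prime containing xs there is already a chain of primes of length
    dim A, so that m cannot lie strictly above this prime. *)
Lemma prime_over_xs (P : ideal A) : prime_ideal P ->
  {subset submod_pred (seqI xs) <= submod_pred P} -> submod_pred P =i submod_pred m.
Proof.
move=> Pp xsP; have Pm := local_sub noethA localm Pp.1.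
move=> a; apply/idP/idP => [/Pm //|am]; apply: contrapT => /negP aP.
have [|p [[pp pA pinc] pk]] := @regular_prime_chain A A^o noethA xs 1 _ P
    xs_reg.1 (leqnn _) Pp.
  by move=> b; rewrite take_size => bxs; apply/xsP/mem_seqI; rewrite -[b]mulr1.
suff : (n.+1 <= n)%N by rewrite ltnn.
apply: (dimA.2 _ (fun i => if (i <= n)%N then p i else m)).
rewrite -xs_size; split.
- move=> i _ /=; case: (leqP i (size xs)) => [/pp|_] //.
  by have := local_prime noethA localm.
- exact: pA.
- move=> i; rewrite ltnS /=; case: (ltngtP i (size xs)) => // [ix _|-> _].
    exact: pinc.
  by rewrite pk; split=> //; exists a.
Qed.

(** R / xtower j is A / (xs_0, ..., xs_(j-1)). *)
Definition xtower j : ideal R := contract pr (seqI (take j xs)).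

Lemma mem_xtower j r :
  (r \in submod_pred (xtower j)) <-> @in_seq_mul A A^o (take j xs) (pr r).
Proof. by rewrite mem_contract; apply: mem_seqI. Qed.

Lemma mem_xtower0 r : (r \in submod_pred (xtower 0)) <-> pr r = 0.
Proof. by rewrite mem_xtower take0; apply: in_seq_mul_nil. Qed.

Lemma xtower_tower : tower xtower (fun j => inj xs`_j) n.
Proof.
move=> j; rewrite -xs_size => jn; split=> [r|r /mem_xtower].
  apply/idP/idP.
    move=> /mem_xtower/(in_seq_mul_take _ jn)[u ru]; apply/mem_addI; exists (inj u).
    by apply/mem_xtower; rewrite rmorphB rmorphM !prK [u * _]mulrC.
  move=> /mem_addI[c /mem_xtower rc]; apply/mem_xtower/in_seq_mul_take => //.
  by exists (pr c); move: rc; rewrite rmorphB rmorphM prK [pr c * _]mulrC.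
rewrite rmorphM prK mulrC => /(xs_reg.1 j jn) rx.
exact/mem_xtower.
Qed.


Section Resolution.
Variables (E : nat -> lmodType R) (e : {linear R^o -> E 0%N}).
Variable d : forall k, {linear E k -> E k.+1}.
Hypothesis resE : injective_resolution e d.
Variable top : nat.
Hypothesis E_top : forall i, (top < i)%N -> forall z : E i, z = 0.

Let injE : forall k, injective_module (E k) := resolution_inj resE.
Let dd : forall k x, d k.+1 (d k x) = 0 := resolution_dd resE.
Let e_inj : injective e. Proof. by case: resE. Qed.

Lemma fin_gen_regular : fin_gen R^o.
Proof.
exists 1%N, (fun=> 1) => x; exists (fun=> x).
by rewrite big_ord1 [_ *: _]mulr1.
Qed.

Lemma acyc_free (I : ideal R) i :
  (forall a, a \in submod_pred I -> a = 0) -> acyc d I i.+1.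
Proof.
move=> I0 z [_ dz]; have [_ _ _ ex] := resE.
have [w ->] := (ex i z).1 dz.
by exists w => // a /I0 ->; rewrite scale0r.
Qed.

Lemma cocyc_free (I : ideal R) z :
  (forall a, a \in submod_pred I -> a = 0) ->
  cocyc d I z <-> exists r, z = e r.
Proof.
move=> I0; have [_ _ ex _] := resE; rewrite -ex; split=> [[]//|dz]; split=> //.
by move=> a /I0 ->; rewrite scale0r.
Qed.

Lemma cyc_free (I : ideal R) :
  (forall a, a \in submod_pred I -> a = 0) -> cyc d I 0.
Proof.
move=> I0; exists (e 1); first by apply/cocyc_free => //; exists 1.
move=> z /(cocyc_free _ I0)[r ->]; exists r.
by rewrite /= -linearZ /= [r *: _]mulr1 subrr.
Qed.

Lemma seqI_tower (ys : seq R) : regular_seq R^o ys ->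
  tower (fun j => seqI (take j ys)) (fun j => ys`_j) (size ys).
Proof.
move=> [reg _] j js; split=> [r|r /mem_seqI]; last first.
  by rewrite mulrC => /(reg j js) ?; apply/mem_seqI.
apply/idP/idP => [/mem_seqI/(in_seq_mul_take _ js)[u ru]|/mem_addI[c rc]].
  by apply/mem_addI; exists u; apply/mem_seqI; rewrite mulrC.
apply/mem_seqI/in_seq_mul_take => //; exists c.
by rewrite [_ *: _]mulrC; apply/mem_seqI.
Qed.

Lemma seqI0 (ys : seq R) a : a \in submod_pred (seqI (take 0 ys)) -> a = 0.
Proof. by move=> /mem_seqI; rewrite take0 => /in_seq_mul_nil. Qed.

Lemma seqI_acyc_below (ys : seq R) : regular_seq R^o ys ->
  forall i, (i < size ys)%N -> acyc d (seqI ys) i.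
Proof.
move=> reg i iy; have := seqI_tower reg => towerY.
rewrite -[ys]take_size.
apply: (tower_acyc_below injE dd towerY (leqnn _)) => // [k|k z ky].
  by apply: acyc_free => a; apply: seqI0.
move=> /cocyc_free[|r ->]; first by move=> a; apply: seqI0.
rewrite -linearZ.
have multsE := @mults_in_seq_mul R R idfun E d (fun j => seqI (take j ys)) R^o e ys k.
rewrite !multsE ?(ltnW ky) //; try by move=> *; rewrite linearD linearZ.
- exact: reg.1.
- by move=> w; apply: cocyc_free => a; apply: seqI0.
- by move=> w; apply: cocyc_free => a; apply: seqI0.
Qed.

(** Multiplication by v embeds the residue field into R / I. *)
Lemma colon_socle (I : ideal R) v : v \notin submod_pred I ->
  (forall a, a \in submod_pred maxR -> a * v \in submod_pred I) ->
  submod_pred (colon I v) =i submod_pred maxR.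
Proof.
move=> vI mv; have vm : {subset submod_pred (colon I v) <= submod_pred maxR}.
  apply: (local_sub noethR local_maxR); apply/negP => /mem_colon.
  by rewrite mul1r; apply/negP.
by move=> a; apply/idP/idP => [/vm //|/mv av]; apply/mem_colon.
Qed.

Lemma not_acyc_zero : ~ acyc d (zeroI R) 0.
Proof.
move=> a0; have [I1 _] := local_prime noethR local_maxR; move/negP: I1; apply.
suff <- : 0 = 1 :> R^o by apply: (ideal0 maxR).
apply/esym/e_inj; rewrite linear0; apply: a0.
by apply/cocyc_free => [a /mem_zeroI|]; [|exists 1].
Qed.

Hypothesis xs_max : forall s', {subset s' <= submod_pred m} ->
  regular_seq A^o s' -> (size s' <= size xs)%N.

Lemma xtower_socle : exists v, submod_pred (colon (xtower n) v) =i submod_pred maxR.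
Proof.
have [w wx mw] := max_regular_socle noethA localm xs_m xs_reg xs_max.
exists (inj w); apply: colon_socle => [|a /mem_maxR/mw aw].
  apply/negP => /mem_xtower; rewrite prK -xs_size take_size => wxs.
  by move/negP: wx; apply; apply/mem_seqI.
by apply/mem_xtower; rewrite rmorphM prK -xs_size take_size; apply/mem_seqI.
Qed.

(** Let k be the residue field, r the largest degree with Ext^r(k, R) nonzero
    (it exists by acyc_vanishing and not_acyc_zero), and ys a maximal
    regular sequence of R.  Since k embeds in R / (ys), which has projective
    dimension size ys, we get r <= size ys <= dim R <= n.  Since k embeds in
    A / (xs), a strict inequality r < n is impossible: Nakayama's lemma down the
    tower of xs would annihilate the cohomology of A, hence that of A / (xs),
    hence Ext^r(k, R).  So r = n = size ys; vanishing below n comes from ys, and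
    Ext^n(k, R) is cyclic as a quotient of Ext^n(R / (ys), R) = R / (ys). *)
Lemma residue_cohomology :
  [/\ forall i, i != n -> acyc d maxR i, ~ acyc d maxR n, cyc d maxR n &
      forall I i, (n < i)%N -> acyc d I i].
Proof.
have vanish := acyc_vanishing noethR local_maxR fin_gen_regular resE E_top.
have [r [nar ar]] : exists r, ~ acyc d maxR r /\
    forall i, (r < i)%N -> acyc d maxR i.
  pose Q i := `[< ~ acyc d maxR i >].
  have exQ : exists i, Q i.
    apply: contrapT => noQ; apply: not_acyc_zero; apply: (vanish 0%N) => // i _.
    by apply: contrapT => nai; apply: noQ; exists i; apply/asboolP.
  have Qtop i : Q i -> (i <= top)%N.
    move=> /asboolP nai; rewrite leqNgt; apply/negP => ti; apply: nai => z _.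
    by rewrite (E_top ti z); case: (bnd_submod d maxR i).
  case: (ex_maxnP exQ Qtop) => r /asboolP nar rmax; exists r; split=> // i ri.
  apply: contrapT => nai; have /rmax : Q i by apply/asboolP.
  by rewrite leqNgt ri.
have aabove I i : (r < i)%N -> acyc d I i by apply: vanish.
have [ys [ys_m ys_reg] ys_max] : exists2 ys : seq R,
    {subset ys <= submod_pred maxR} /\ regular_seq R^o ys &
    forall s', {subset s' <= submod_pred maxR} /\ regular_seq R^o s' ->
      (size s' <= size ys)%N.
  apply: (exists_longest (n := n)) => [|s [_ sreg]].
    exists [::]; split=> //; split=> //; exists 1 => /in_seq_mul_nil/eqP; apply/negP.
    have [I1 _] := local_prime noethR local_maxR.
    by apply: contraNneq I1 => ->; apply: (ideal0 maxR).
  have [p pp] := regular_seq_chain noethR local_maxR sreg.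
  exact: retract_chain_le pp.
have ys_n : (size ys <= n)%N.
  have [p pp] := regular_seq_chain noethR local_maxR ys_reg.
  exact: retract_chain_le pp.
have [|v vy mv] := max_regular_socle noethR local_maxR ys_m ys_reg.
  by move=> s' s'm s'reg; apply: ys_max.
have colon_v := colon_socle vy mv.
have towerY := seqI_tower ys_reg.
have Y0 a := @seqI0 ys a.
have ry : (r <= size ys)%N.
  rewrite leqNgt; apply/negP => yr; apply/nar/(acyc_eq colon_v)/acyc_colon => //.
    rewrite -[ys]take_size; apply: (tower_acyc_above injE dd towerY) => // k.
    exact: acyc_free.
  by apply: aabove.
have rn : r = n.
  apply/eqP; rewrite eqn_leq (leq_trans ry ys_n) /= leqNgt; apply/negP => rn.
  have a0 i : acyc d (xtower 0) i.
    apply: (tower_acyc_down noethR local_maxR fin_gen_regular resE xtower_tower) (add0n n) _.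
      move=> k kn; apply/mem_maxR; rewrite prK; apply/xs_m/mem_nth.
      by rewrite xs_size.
    by apply/aabove/(leq_trans rn); apply: leq_addl.
  have [w xw] := xtower_socle.
  apply/nar/(acyc_eq xw)/acyc_colon => //; last exact: aabove.
  exact: (tower_acyc_all injE dd xtower_tower).
move: nar ar aabove ry; rewrite rn => nar ar aabove ny.
have yn : size ys = n by apply/eqP; rewrite eqn_leq ys_n ny.
split=> // [i|].
  rewrite neq_ltn => /orP[i_n|/ar //].
  apply: (acyc_above_ideal noethR resE (I0 := seqI ys) (t := n)) => // [k kn|a].
    by apply: seqI_acyc_below; rewrite ?yn.
  by move=> /mem_seqI; apply: in_seq_mul_ideal.
apply: (cyc_eq colon_v); apply: cyc_colon => //; last exact: aabove.
rewrite -yn -{1}[ys]take_size; apply: (tower_cyc injE dd towerY) => // [k|].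
  exact: acyc_free.
exact: cyc_free.
Qed.


(* kap identifies K with the annihilator of the kernel of pr, which is
   Hom_R(A, R). *)
Variables (K : lmodType A) (kap : K -> R).
Hypothesis kap_linear : forall a z z', kap (a *: z + z') = inj a * kap z + kap z'.
Hypothesis kap_inj : injective kap.
Hypothesis kap_im : forall r,
  (forall c, pr c = 0 -> c * r = 0) <-> exists z, r = kap z.

Definition ekap (z : K) : E 0%N := e (kap z).

Lemma ekap_linear a z z' : ekap (a *: z + z') = inj a *: ekap z + ekap z'.
Proof.
rewrite /ekap kap_linear -linearZ /=.
by rewrite -[inj a * _]/(inj a *: (kap z : R^o)) linearD.
Qed.

Lemma ekap_inj : injective ekap.
Proof. by move=> z z' /e_inj/kap_inj. Qed.

Lemma cocyc_ekap w : cocyc d (xtower 0) w <-> exists z, w = ekap z.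
Proof.
have [_ _ ex _] := resE; split=> [[wT /ex[r wr]]|[z ->]].
  have /kap_im[z rz] : forall c, pr c = 0 -> c * r = 0.
    move=> c c0; apply: e_inj; rewrite -[c * r]/(c *: (r : R^o)) linear0 linearZ /=.
    by rewrite -wr; apply/wT/mem_xtower0.
  by exists z; rewrite wr rz.
split; last by apply/ex; exists (kap z).
move=> c /mem_xtower0 c0; rewrite /ekap -linearZ /= [c *: _]((kap_im _).2 _ c c0).
  by rewrite linear0.
by exists z.
Qed.

(** For xtower n, this follows from residue_cohomology by devissage, maxR being
    the only prime above it; Nakayama's lemma then goes down the tower. *)
Lemma xtower_acyc j i : (j <= n)%N -> i != j -> acyc d (xtower j) i.
Proof.
have [ane _ _ above] := residue_cohomology.
have xtop k : k != n -> acyc d (xtower n) k.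
  move=> kn; apply: (acyc_devissage noethR resE) => P Pp xP.
  apply: acyc_eq (ane k kn) => r.
  have Pm := local_sub noethR local_maxR Pp.1.
  apply/idP/idP => [/mem_maxR rm|/Pm //].
  have PA : submod_pred (contract inj P) =i submod_pred m.
    apply: prime_over_xs; first exact: contract_prime.
    move=> a /mem_seqI ax; apply/mem_contract/xP/mem_xtower.
    by rewrite prK -xs_size take_size.
  have /mem_contract prP : pr r \in submod_pred (contract inj P) by rewrite PA.
  rewrite -[r](subrK (inj (pr r))); apply: idealD => //; apply/xP/mem_xtower.
  by rewrite pr_kernel; apply: (@in_seq_mul_submod A A^o _).1.
move=> jn ij.
apply: (tower_acyc_down noethR local_maxR fin_gen_regular resE xtower_tower)
  (subnKC jn) _.
  move=> k kn; apply/mem_maxR; rewrite prK; apply/xs_m/mem_nth.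
  by rewrite xs_size.
apply: xtop; apply: contra ij => /eqP ijn.
by rewrite -(eqn_add2r (n - j)) ijn subnKC.
Qed.

Lemma xtower_connected j : (j <= n)%N -> connected d xtower (fun i => inj xs`_i) j.
Proof.
move=> jn; apply: (tower_connected injE dd xtower_tower) => // i ij.
by apply: xtower_acyc; [apply/ltnW/(leq_trans ij) | rewrite gtn_eqF].
Qed.

Lemma mults_ekap j z : (j <= n)%N ->
  mults d xtower (fun i => inj xs`_i) j (ekap z) <-> in_seq_mul (take j xs) z.
Proof.
move=> jn; apply: mults_in_seq_mul => //; first exact: ekap_linear.
- exact: ekap_inj.
- exact: cocyc_ekap.
- by rewrite xs_size.
Qed.

Lemma xs_regular_kernel : regular_seq K xs.
Proof.
split=> [i|].
  rewrite xs_size => i_n z; rewrite -!mults_ekap ?(ltnW i_n) //.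
  have -> : ekap (xs`_i *: z) = inj xs`_i *: ekap z.
    have := ekap_linear xs`_i z (- z + z).
    rewrite addNr addr0 => ->; rewrite -[RHS]addr0; congr (_ + _).
    by have := ekap_linear (-1) z z; rewrite scaleN1r addNr rmorphN1 scaleN1r addNr.
  apply: (connected_regular injE dd xtower_tower i_n (xtower_connected (ltnW i_n))).
    by apply: xtower_acyc => //; rewrite ltn_eqF.
  by apply/cocyc_ekap; exists z.
apply: contrapT => noy; have [_ nan _ above] := residue_cohomology.
have [w xw] := xtower_socle; apply/nan/(acyc_eq xw)/acyc_colon => //; last exact: above.
move=> w' w'c; have cn := xtower_connected (leqnn n).
have [_ _ _ _ onto /(_ w') link_bnd link_mults] := cn.
have [z zw] := onto w' w'c; apply/link_bnd.
have z0 := link_cocyc0 cn zw.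
have [y zy] := (cocyc_ekap z).1 z0.
have z_0 : link d xtower (fun i => inj xs`_i) z (0 : E n).
  apply/link_mults => //; rewrite zy; apply/mults_ekap => //.
  rewrite -xs_size take_size; apply: contrapT => nxy; apply: noy.
  by exists y.
by rewrite -(subrr z) -[w']subr0; apply: linkB.
Qed.

Fact kernel_tors_closed i :
  is_submod (tors (xtower 0) : restr inj (E i) -> Prop).
Proof.
split=> [|a x y xT yT]; first exact: (@tors_submod _ _ _).1.
exact: ((@tors_submod _ (E i) _).2 (inj a)).
Qed.

(** Hom_R(A, E), seen as the torsion of the kernel of the retraction.  It is an
    injective resolution of K over A because Ext^i_R(A, R) = 0 for i > 0. *)
Definition homE i : lmodType A := submod_of (mk_submodule (@kernel_tors_closed i)).

Definition homE_val i (w : homE i) : E i := submod_val w.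

Lemma homE_tors i (w : homE i) : tors (xtower 0) (homE_val w).
Proof. exact/(mem_mk_submodule (@kernel_tors_closed i))/(submod_valP w). Qed.

Definition homE_mk i (w : E i) (wT : tors (xtower 0) w) : homE i :=
  SubmodOf ((mem_mk_submodule (@kernel_tors_closed i) w).2 wT).

Lemma homE_valL i a (w w' : homE i) :
  homE_val (a *: w + w') = inj a *: homE_val w + homE_val w'.
Proof. by []. Qed.

Lemma homE_val_inj i : injective (@homE_val i).
Proof. exact: val_inj. Qed.

Lemma homE_scale i (w : homE i) r : r *: homE_val w = inj (pr r) *: homE_val w.
Proof.
apply/eqP; rewrite -subr_eq0 -scalerBl; apply/eqP/homE_tors/mem_xtower0.
exact: pr_kernel.
Qed.

Fact d_tors i (w : homE i) : tors (xtower 0) (d i (homE_val w)).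
Proof. by move=> r r0; rewrite -linearZ homE_tors // linear0. Qed.

Definition hom_d_fun i (w : homE i) : homE i.+1 := homE_mk (@d_tors i w).

Fact hom_d_linear i a (w w' : homE i) :
  hom_d_fun (a *: w + w') = a *: hom_d_fun w + hom_d_fun w'.
Proof. by apply: homE_val_inj; rewrite homE_valL -linearZ -linearD. Qed.

Definition hom_d i : {linear homE i -> homE i.+1} := mk_linear (@hom_d_linear i).

Fact ekap_tors z : tors (xtower 0) (ekap z).
Proof. by have [] := (cocyc_ekap (ekap z)).2 (ex_intro _ z erefl). Qed.

Fact hom_e_linear a z z' :
  homE_mk (ekap_tors (a *: z + z')) = a *: homE_mk (ekap_tors z) + homE_mk (ekap_tors z').
Proof. by apply: homE_val_inj; rewrite homE_valL; apply: ekap_linear. Qed.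

Definition hom_e : {linear K -> homE 0%N} := mk_linear hom_e_linear.

(** An A-linear map to Hom_R(A, E) is the same as an R-linear map to E, the ring
    R acting on A-modules through the retraction. *)
Lemma homE_injective i : injective_module (homE i).
Proof.
move=> M N f g f_inj.
pose fR : restr pr M -> restr pr N := f.
pose gR (x : restr pr M) : E i := homE_val (g x).
have fRL a x y : fR (a *: x + y) = a *: fR x + fR y by rewrite /fR linearD linearZ.
have gRL a x y : gR (a *: x + y) = a *: gR x + gR y.
  by rewrite /gR linearD linearZ homE_valL -homE_scale.
have [h hg] := injE (i := mk_linear fRL) (mk_linear gRL) f_inj.
have h0 (r : R) (y : restr pr N) : pr r = 0 -> r *: h y = 0.
  by move=> r0; rewrite -linearZ /= restrZ r0 scale0r linear0.
have hT (y : N) : tors (xtower 0) (h y).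
  by move=> r /mem_xtower0; apply: h0.
have hL a (x y : N) : homE_mk (hT (a *: x + y)) = a *: homE_mk (hT x) + homE_mk (hT y).
  apply: homE_val_inj; rewrite homE_valL /=.
  have -> : a *: x + y = (inj a *: (x : restr pr N) + y : restr pr N) by rewrite restrZ prK.
  by rewrite -linearZ -linearD.
exists (mk_linear hL) => x; apply: homE_val_inj.
exact: hg.
Qed.

Lemma homE_resolution : injective_resolution hom_e hom_d.
Proof.
split.
- exact: homE_injective.
- by move=> z z' /(congr1 (@homE_val 0)); apply: ekap_inj.
- move=> w; split=> [/(congr1 (@homE_val 1)) dw|[z ->]].
    have /cocyc_ekap[z wz] : cocyc d (xtower 0) (homE_val w).
      by split; [apply: homE_tors | apply: dw].
    by exists z; apply: homE_val_inj.
  by apply: homE_val_inj; case: ((cocyc_ekap (ekap z)).2 (ex_intro _ z erefl)).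
- move=> i w; split=> [/(congr1 (@homE_val i.+2)) dw|[w' ->]].
    have [|u uT wu] := @xtower_acyc 0 i.+1 (leq0n n) isT (homE_val w).
      by split; [apply: homE_tors | apply: dw].
    by exists (homE_mk uT); apply: homE_val_inj.
  by apply: homE_val_inj; apply: dd.
Qed.

Lemma tors_maxR_kernel i (w : E i) : tors maxR w -> tors (xtower 0) w.
Proof.
by apply: tors_sub => r /mem_xtower0 r0; apply/mem_maxR; rewrite r0; apply: ideal0.
Qed.

Lemma tors_homE i (w : E i) (wT : tors (xtower 0) w) :
  tors maxR w <-> tors m (homE_mk wT).
Proof.
split=> [wm a am|wm r /mem_maxR/wm/(congr1 (@homE_val i)) r0].
  by apply: homE_val_inj; apply: wm; apply/mem_maxR; rewrite prK.
by rewrite -[w]/(homE_val (homE_mk wT)) homE_scale.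
Qed.

Lemma residue_coboundary i (w : homE i) (g : quot_mod m -> homE i) :
  (forall a, g (quot_pi m a) = a *: w) ->
  ext_coboundary hom_d g <-> bnd d maxR (homE_val w).
Proof.
move=> gw; have gw1 : g (quot_pi m 1) = w by rewrite gw scale1r.
case: i w g gw gw1 => [|i] w g gw gw1 /=.
  split=> [g0|w0 q]; first by rewrite -gw1 g0.
  by rewrite -[q]quot_piK gw; apply: homE_val_inj; rewrite -[LHS]/(inj _ *: homE_val w) w0 scaler0.
split=> [[h gh]|[u um wu]].
  exists (homE_val (h (quot_pi m 1))); last by rewrite -gw1 gh.
  move=> r /mem_maxR rm; rewrite homE_scale.
  rewrite -[LHS]/(homE_val (pr r *: h (quot_pi m 1))) -linearZ /=.
  by rewrite quot_scale_mem // linear0.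
have uT := tors_maxR_kernel um.
have [h hu] := quot_linear ((tors_homE uT).1 um).
exists h => q; rewrite -[q]quot_piK gw hu; apply: homE_val_inj.
by rewrite -[LHS]/(inj _ *: homE_val w) wu -linearZ.
Qed.

(** Homomorphisms from k = A / m = R / maxR to Hom_R(A, E) and to E coincide, so
    Ext^n_A(k, K) is the cohomology of maxR in degree n, cyclic and nonzero. *)
Lemma kernel_residue_dim : ext_residue_dim m K n 1.
Proof.
have [_ nan [g [gm dg] gen] _] := residue_cohomology.
exists homE, hom_e, hom_d; split; first exact: homE_resolution.
have gT := tors_maxR_kernel gm.
have [z zg] := quot_linear ((tors_homE gT).1 gm).
exists (fun=> z); split.
- move=> _ q; rewrite -[q]quot_piK zg linearZ; apply: homE_val_inj.
  by rewrite -[LHS]/(inj _ *: d n g) dg scaler0.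
- move=> G cG; set w := G (quot_pi m 1).
  have Gw (a : A) : G (quot_pi m a) = a *: w.
    rewrite /w -linearZ /= -[a *: quot_pi m 1]/(quot_scale a _) quot_scale_pi.
    by rewrite [_ *: _]mulr1.
  have [|c wc] := gen (homE_val w).
    split; last by have /(congr1 (@homE_val _)) := cG (quot_pi m 1).
    move=> r /mem_maxR rm; rewrite homE_scale.
    rewrite -[LHS]/(homE_val (pr r *: w)) /w -linearZ /=.
    by rewrite quot_scale_mem // linear0.
  exists (fun=> pr c); apply/(residue_coboundary (w := w - pr c *: homE_mk gT)).
    by move=> a; rewrite big_ord1 Gw zg scalerBr !scalerA mulrC.
  by move: wc; rewrite -[g]/(homE_val (homE_mk gT)) homE_scale.
- move=> c cz i; apply: contrapT => /negP cm; apply: nan.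
  have [b bc] := local_unit noethA localm cm.
  have cg (a : A) : \sum_(j < 1) c j *: z (quot_pi m a) =
      a *: (c i *: homE_mk gT).
    by rewrite big_ord1 zg !scalerA mulrC (ord1 i).
  have := (residue_coboundary (g := fun q => \sum_(j < 1) c j *: z q) cg).1 cz.
  move=> /(is_submodZ (bnd_submod d maxR n) (inj b)).
  rewrite -[homE_val _]/(inj (c i) *: g) scalerA -rmorphM bc rmorph1 scale1r => gb.
  move=> w /gen[a wa]; rewrite -(subrK (a *: g) w).
  apply: (is_submodD (bnd_submod d maxR n)) => //.
  exact: (is_submodZ (bnd_submod d maxR n)).
Qed.

Hypothesis finK : fin_gen K.

Lemma retract_canonical : canonical_module m K.
Proof.
have chainK k p : prime_chain K k p -> (k <= n)%N.
  by move=> /prime_chain_regular; apply: dimA.2.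
have dimK : has_dim K n.
  split=> //; rewrite -xs_size; exact: (regular_seq_chain noethA localm xs_regular_kernel).
have depthK : has_depth m K n.
  split=> [|s sm sreg]; first by exists xs; split=> //; apply: xs_regular_kernel.
  by have [p /chainK] := regular_seq_chain noethA localm sreg.
split; first by split; [split; last exists n | exists n].
  by exists n => //; apply: kernel_residue_dim.
exists homE, hom_e, hom_d; split; first exact: homE_resolution.
exists top => i ti w; apply: homE_val_inj; exact: E_top.
Qed.

End Resolution.
End Dimension.
End Retract.

(** * The amalgamation as a retract *)

Section AmalgamationRetract.
Variables (A B : comPzRingType) (f : {rmorphism A -> B}) (J : ideal B).
Local Notation R := (amalgamation f J).

Lemma amalg_eq (x y : R) :
  (amalg_val x).1 = (amalg_val y).1 -> (amalg_val x).2 = (amalg_val y).2 -> x = y.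
Proof.
move=> e1 e2; apply: val_inj; rewrite /= [LHS]surjective_pairing e1 e2.
by rewrite -surjective_pairing.
Qed.

Fact diag_amalg a : (a, f a) \in amalg_pred f J.
Proof. by rewrite amalg_predE subrr; apply: ideal0. Qed.

Definition diag_fun (a : A) : R := Amalgamation (diag_amalg a).

Fact diag_zmod : zmod_morphism diag_fun.
Proof. by move=> a b; apply: amalg_eq => //=; rewrite rmorphB. Qed.
Fact diag_monoid : monoid_morphism diag_fun.
Proof.
by split=> [|a b]; apply: amalg_eq => //=; rewrite ?rmorph1 ?rmorphM.
Qed.
Definition diag : {rmorphism A -> R} := HB.pack diag_fun
  (GRing.isZmodMorphism.Build A R diag_fun diag_zmod)
  (GRing.isMonoidMorphism.Build A R diag_fun diag_monoid).

Definition proj_fun (x : R) : A := (amalg_val x).1.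
Fact proj_zmod : zmod_morphism proj_fun. Proof. by []. Qed.
Fact proj_monoid : monoid_morphism proj_fun. Proof. by []. Qed.
Definition proj : {rmorphism R -> A} := HB.pack proj_fun
  (GRing.isZmodMorphism.Build R A proj_fun proj_zmod)
  (GRing.isMonoidMorphism.Build R A proj_fun proj_monoid).

Lemma diagK : cancel diag proj. Proof. by []. Qed.

Lemma in_amalg0 j : ((0, j) \in amalg_pred f J) = (j \in submod_pred J).
Proof. by rewrite amalg_predE /= rmorph0 subr0. Qed.

Lemma amalg_fin_gen : fin_gen_via f J -> fin_gen (restr diag R^o).
Proof.
move=> [n [v [vJ gen]]].
have v_amalg i : (0, v i) \in amalg_pred f J by rewrite in_amalg0.
pose g (i : 'I_n.+1) : R :=
  if unlift ord0 i is Some k then Amalgamation (v_amalg k) else 1.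
exists n.+1, g => x; have [c xc] := gen _ (amalg_valP x).
exists (fun i => if unlift ord0 i is Some k then c k else proj x).
rewrite big_ord_recl /g unlift_none.
under eq_bigr do rewrite liftK.
have scaleE (a : A) (y : restr diag R^o) : a *: y = diag a * (y : R) by [].
rewrite scaleE mulr1; under eq_bigr do rewrite scaleE.
have sumE (F : 'I_n -> R) : amalg_val (\sum_i F i) =
    (\sum_i (amalg_val (F i)).1, \sum_i (amalg_val (F i)).2).
  elim/big_rec3: _ => // i y1 y2 y3 _ e.
  by rewrite -[LHS]/(amalg_val (F i) + amalg_val y3) e.
apply: amalg_eq.
  rewrite -[RHS]/(proj x + (amalg_val (\sum_i diag (c i) * Amalgamation (v_amalg i))).1).
  rewrite sumE /= big1 ?addr0 // => i _; exact: mulr0.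
rewrite -[RHS]/(f (proj x) + (amalg_val (\sum_i diag (c i) * Amalgamation (v_amalg i))).2).
by rewrite sumE /= -[LHS](subrK (f (proj x))) xc addrC.
Qed.

Fact preim_amalg (z : submod_of (preim_ideal f J)) :
  (submod_val z : A, 0) \in amalg_pred f J.
Proof.
rewrite amalg_predE /= sub0r -mulN1r.
exact/idealM/(submod_valP z).
Qed.

Definition kernel_ann (z : submod_of (preim_ideal f J)) : R :=
  Amalgamation (preim_amalg z).

Lemma kernel_ann_linear a z z' :
  kernel_ann (a *: z + z') = diag a * kernel_ann z + kernel_ann z'.
Proof.
apply: amalg_eq => //=.
by rewrite -[RHS]/(f a * 0 + 0) mulr0 addr0.
Qed.

Lemma kernel_ann_inj : injective kernel_ann.
Proof. by move=> z z' /(congr1 proj) e; apply: val_inj. Qed.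

(** An element that kills {0} x J, the kernel of the projection, has its second
    component in Ann(J) = 0, which puts the first one in f^-1(J). *)
Lemma kernel_annE (ann_J : forall x : B, in_annihilator f J x <-> x = 0) (r : R) :
  (forall c, proj c = 0 -> c * r = 0) <-> exists z, r = kernel_ann z.
Proof.
split=> [rann|[z -> c c0]]; last first.
  apply: amalg_eq; rewrite /= ?mulr0 //.
  by rewrite -[LHS]/(proj c * _) c0 mul0r.
have r2 : (amalg_val r).2 = 0.
  apply/ann_J; split=> [|j jJ].
    exists (amalg_val r).1, ((amalg_val r).2 - f (amalg_val r).1).
    by split; [apply: amalg_valP | rewrite addrC subrK].
  have j_amalg : (0, j) \in amalg_pred f J by rewrite in_amalg0.
  have /(congr1 (fun y => (amalg_val y).2)) := rann (Amalgamation j_amalg) erefl.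
  by rewrite mulrC.
have r1 : (amalg_val r).1 \in submod_pred (preim_ideal f J).
  have := amalg_valP r; rewrite amalg_predE r2 sub0r => /(idealM (-1)).
  by rewrite mulN1r opprK.
by exists (SubmodOf r1); apply: amalg_eq.
Qed.

End AmalgamationRetract.

Theorem proposition5p5 (A B : comPzRingType) (f : {rmorphism A -> B})
    (J : ideal B) (m : ideal A)
    (A_noetherian : noetherian A)
    (A_local : local_at m)
    (J_jac : forall x : B, x \in submod_pred J -> in_jacobson_radical x)
    (J_fin_gen : fin_gen_via f J)
    (A_CM : cohen_macaulay m)
    (ann_J : forall x : B, in_annihilator f J x <-> x = 0)
    (AJ_gorenstein : gorenstein (amalgamation f J)) :
  exists K : lmodType A,
    canonical_module m K /\ isomorphic K (submod_of (preim_ideal f J)).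
Proof.
have [noethR localR [E [e [d [resE [top E_top]]]]]] := AJ_gorenstein.
have [_ [n [[[xs [xs_m xs_reg xs_size]] depth_max] dimA]]] := A_CM.
exists (submod_of (preim_ideal f J)); split; last first.
  by exists idfun; exists id.
apply: (retract_canonical (@diagK A B f J) A_noetherian A_local noethR localR
  (amalg_fin_gen J_fin_gen) dimA xs_m xs_reg xs_size resE E_top _
  (@kernel_ann_linear _ _ f J) (@kernel_ann_inj _ _ f J) (kernel_annE ann_J)).
  by move=> s sm sreg; rewrite xs_size; apply: depth_max.
exact: A_noetherian.
Qed.
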